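(* Let $\mathcal{T}$ be a three-dimensional textile system with directed graphs $G,F_1,F_2,E$ and graph homomorphisms $p_1,q_1:G\to F_1$, $p_2,q_2:G\to F_2$, $g_1,h_1:F_1\to E$, $g_2,h_2:F_2\to E$. Suppose $q_1$ has $s$-path lifting and that: (i) $g_1,g_2$ have unique $r$-path lifting; (ii) $h_1,h_2$ have unique $s$-path lifting; (iii) the commutative squares of sets formed by $q_1^0:G^0\to F_1^0$, $p_2^0:G^0\to F_2^0$, $g_1^0:F_1^0\to E^0$, $h_2^0:F_2^0\to E^0$ (with $g_1^0q_1^0=h_2^0p_2^0$), and by $p_1^0:G^0\to F_1^0$, $q_2^0:G^0\to F_2^0$, $h_1^0:F_1^0\to E^0$, $g_2^0:F_2^0\to E^0$ (with $h_1^0p_1^0=g_2^0q_2^0$), are pullback squares in the category of sets. Let $\Lambda_{\mathcal{T}}$ be the associated $3$-graph. Then the chain complex $(C_*(\mathcal{T}),\partial_*^{\mathcal{T}})$ is isomorphic to the chain complex $(C_*(\Lambda_{\mathcal{T}}),\partial_*^{\Lambda_{\mathcal{T}}})$. Consequently, $H_n(\mathcal{T})\cong H_n(\Lambda_{\mathcal{T}})$ for all $n\in\mathbb{N}$.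
   Context: A directed graph is written $E=(E^0,E^1,r_E,s_E)$: vertices, edges, range, source. A graph homomorphism $f=(f^0,f^1)$ consists of a vertex map and an edge map commuting with ranges and sources (superscripts are often dropped). $f:F\to E$ has $r$-path lifting (resp. $s$-path lifting) if whenever $v\in F^0$, $e\in E^1$ and $f^0(v)=r_E(e)$ (resp. $f^0(v)=s_E(e)$) there is $x\in F^1$ with $r_F(x)=v$ (resp. $s_F(x)=v$) and $f^1(x)=e$; the lifting is unique if $x$ is always unique. A three-dimensional textile system consists of directed graphs and graph homomorphisms as in the claim such that ($\mathcal C$) $g_1p_1=g_2p_2$, $h_1q_1=h_2q_2$, $g_1q_1=h_2p_2$, $h_1p_1=g_2q_2$; and ($\mathcal I$) the following maps are injective: $s_G\times r_G\times p_1^1\times q_1^1\times p_2^1\times q_2^1$ on $G^1$; $p_1^0\times q_1^0\times p_2^0\times q_2^0$ on $G^0$; $s_{F_1}\times r_{F_1}\times g_1^1\times h_1^1$ on $F_1^1$; $s_{F_2}\times r_{F_2}\times g_2^1\times h_2^1$ on $F_2^1$. Homology of $\mathcal T$ ($\mathbb{Z}S$ is the free abelian group on $S$): $C_0(\mathcal T)=\mathbb{Z}E^0$, $C_1(\mathcal T)=\mathbb{Z}(F_1^0\sqcup F_2^0\sqcup E^1)$, $C_2(\mathcal T)=\mathbb{Z}(G^0\sqcup F_1^1\sqcup F_2^1)$, $C_3(\mathcal T)=\mathbb{Z}G^1$, $C_n(\mathcal T)=0$ for $n\ge4$. The boundary maps are: $\partial_1^{\mathcal T}(x)=h_i^0(x)-g_i^0(x)$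 for $x\in F_i^0$ ($i=1,2$) and $r_E(x)-s_E(x)$ for $x\in E^1$; $\partial_2^{\mathcal T}(x)=p_2^0(x)+q_1^0(x)-p_1^0(x)-q_2^0(x)$ for $x\in G^0$ and $s_{F_i}(x)+h_i^1(x)-g_i^1(x)-r_{F_i}(x)$ for $x\in F_i^1$; $\partial_3^{\mathcal T}(x)=r_G(x)+p_2^1(x)+q_1^1(x)-s_G(x)-p_1^1(x)-q_2^1(x)$ for $x\in G^1$; all others zero. $H_n(\mathcal T)=\ker\partial_n^{\mathcal T}/\operatorname{im}\partial_{n+1}^{\mathcal T}$. A $k$-graph is a small category $\Lambda$ (codomain $r_\Lambda$, domain $s_\Lambda$) with a functor $d:\Lambda\to\mathbb{N}^k$ ($\mathbb N$ includes $0$) such that $d(\lambda)=\mathbf n+\mathbf m$ implies $\lambda=\alpha\beta$ for unique $\alpha,\beta$ with $d(\alpha)=\mathbf n$, $d(\beta)=\mathbf m$. $\lambda(\mathbf n,\mathbf m)$ is the unique element with $\lambda=\alpha\lambda(\mathbf n,\mathbf m)\beta$, $d(\alpha)=\mathbf n$, $d(\beta)=d(\lambda)-\mathbf m$. Homology of a $k$-graph $\Lambda$: $C_n(\Lambda)$ is the free abelian group on $\{\lambda\mid d(\lambda)\le(1,\dots,1),\ |\lambda|=n\}$, $|\lambda|$ being the sum of the coordinates of $d(\lambda)$. If $d(\lambda)=\sum_{t=1}^n\mathbf e_{i_t}$ with $i_1<\dots<i_n$, put $F_t^0(\lambda)=\lambda(0,d(\lambda)-\mathbf e_{i_t})$,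 $F_t^1(\lambda)=\lambda(\mathbf e_{i_t},d(\lambda))$; $\partial_n^\Lambda(\lambda)=\sum_{l=0}^1\sum_{t=1}^n(-1)^{t+l}F_t^l(\lambda)$ for $1\le n\le k$, other boundary maps zero; $H_n(\Lambda)=\ker\partial_n^\Lambda/\operatorname{im}\partial_{n+1}^\Lambda$. Construction of $\Lambda_{\mathcal T}$. Let $G_{\mathcal T}$ be the directed graph with vertex set $E^0$ and edge set $F_1^0\sqcup F_2^0\sqcup E^1$, where $x\in F_i^0$ has source $g_i(x)$ and range $h_i(x)$ and $x\in E^1$ has source $s_E(x)$ and range $r_E(x)$. Edges in $F_1^0,F_2^0,E^1$ have colors $\mathbf e_2,\mathbf e_1,\mathbf e_3$ respectively; $d$ of a path is the sum of its colors. Paths $x_1x_2\cdots$ satisfy $r(x_i)=s(x_{i+1})$; $G_{\mathcal T}^*$ is the path category. Let $\mathcal R$ be the smallest congruence on $G_{\mathcal T}^*$ such that - $p_2^0(x)q_1^0(x)\,\mathcal R\,p_1^0(x)q_2^0(x)$ for $x\in G^0$; - $s_{F_1}(x)h_1^1(x)\,\mathcal R\,g_1^1(x)r_{F_1}(x)$ for $x\in F_1^1$; - $s_{F_2}(x)h_2^1(x)\,\mathcal R\,g_2^1(x)r_{F_2}(x)$ for $x\in F_2^1$. $\Lambda_{\mathcal T}:=G_{\mathcal T}^*/\mathcal R$ with the induced degree functor; the codomain $r_{\Lambda_{\mathcal T}}$ (resp. domain $s_{\Lambda_{\mathcal T}}$) of a path class is its initial (resp. terminal) vertex. Under the hypotheses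 of the claim, $\Lambda_{\mathcal T}$ is a $3$-graph. *)

(* Defs.v *)
From HB Require Import structures.
From mathcomp Require Import all_boot all_order all_algebra.
From mathcomp Require Import ring_quotient freeg.
From mathcomp Require Import boolp classical_sets.
From mathcomp Require Import zify.

Set Implicit Arguments.
Unset Strict Implicit.
Unset Printing Implicit Defensive.

Import GRing.Theory.
Local Open Scope ring_scope.
Local Open Scope quotient_scope.

(* [bnd n] is the boundary map from degree [n.+1] to degree [n]; the boundary
   map leaving degree 0 is the zero map and is left implicit. *)
Record chain_complex := ChainComplex {
  chain :> nat -> zmodType;
  bnd : forall n, {additive chain n.+1 -> chain n};
  bnd_bnd : forall n (x : chain n.+2), bnd n (bnd n.+1 x) = 0
}.

Definition zmod_iso (A B : zmodType) : Prop :=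
  exists f : {additive A -> B}, bijective f.

Definition complex_iso (C D : chain_complex) : Prop :=
  exists phi : forall n, {additive C n -> D n},
    (forall n, bijective (phi n)) /\
    (forall n (x : C n.+1), phi n (bnd C n x) = bnd D n (phi n.+1 x)).

Section Homology.
Variables (C : chain_complex) (n : nat).

Definition is_cycle (m : nat) : {pred C m} :=
  match m with
  | 0 => xpredT
  | m'.+1 => fun x => bnd C m' x == 0
  end.

Lemma is_cycle_zmod_closed : zmod_closed (@is_cycle n).
Proof.
case: n => [|m] //; split; first by rewrite /in_mem /= raddf0.
by move=> x y; rewrite /in_mem /= raddfB => /eqP-> /eqP->; rewrite subr0.
Qed.

HB.instance Definition _ :=
  GRing.isZmodClosed.Build (C n) (@is_cycle n) is_cycle_zmod_closed.

Record cycles := Cycle { cycle_val :> C n; _ : cycle_val \in @is_cycle n }.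
HB.instance Definition _ := [isSub for cycle_val].
HB.instance Definition _ := [Choice of cycles by <:].
HB.instance Definition _ := [SubChoice_isSubZmodule of cycles by <:].

Definition is_boundary : {pred cycles} :=
  fun z => `[< exists y : C n.+1, bnd C n y = val z >].

Lemma is_boundary_zmod_closed : zmod_closed is_boundary.
Proof.
split; first by apply/asboolP; exists 0; rewrite !raddf0.
move=> x y /asboolP[u xu] /asboolP[v yv]; apply/asboolP.
by exists (u - v); rewrite !raddfB xu yv.
Qed.

HB.instance Definition _ :=
  GRing.isZmodClosed.Build cycles is_boundary is_boundary_zmod_closed.

Definition homology : zmodType := @Quotient.quot cycles is_boundary.

End Homology.
(* The complex of free abelian groups on the sets [B n] whose boundary maps
   extend the maps [d n] additively. *)
Section FreeComplex.
Variables (B : nat -> choiceType) (d : forall n, B n.+1 -> {freeg (B n)}).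

Definition free_bnd n (x : {freeg (B n.+1)}) : {freeg (B n)} :=
  fglift (@d n) x.

HB.instance Definition _ n := GRing.isZmodMorphism.Build _ _ (@free_bnd n)
  (@lift_is_additive int (B n.+1) _ (@d n)).

Lemma free_bndU n (x : B n.+1) : free_bnd << x >> = d x.
Proof. by rewrite /free_bnd liftU scale1r. Qed.

Hypothesis dd : forall n (x : B n.+2), free_bnd (d x) = 0.

Lemma free_bnd_bnd n (x : {freeg (B n.+2)}) : free_bnd (free_bnd x) = 0.
Proof.
rewrite -[x]freeg_sumE !raddf_sum big1 // => z _.
by rewrite -[coeff z x]intz -freegU_mulz !raddfMz /= free_bndU dd mul0rz.
Qed.

Definition free_complex : chain_complex := @ChainComplex
  (fun n => {freeg (B n)} : zmodType)
  (fun n => @free_bnd n) free_bnd_bnd.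

End FreeComplex.

(* Vertex and edge sets are [choiceType]s, with no finiteness assumption. *)
Record digraph := Digraph {
  vertex : choiceType;
  edge : choiceType;
  src : edge -> vertex;
  rng : edge -> vertex
}.

Record ghom (F E : digraph) := GHom {
  hom0 : vertex F -> vertex E;
  hom1 : edge F -> edge E;
  hom_src : forall x, src (hom1 x) = hom0 (src x);
  hom_rng : forall x, rng (hom1 x) = hom0 (rng x)
}.

Section PathLifting.
Variables (F E : digraph) (f : ghom F E).

Definition r_path_lifting : Prop :=
  forall v e, hom0 f v = rng e -> exists x, rng x = v /\ hom1 f x = e.

Definition s_path_lifting : Prop :=
  forall v e, hom0 f v = src e -> exists x, src x = v /\ hom1 f x = e.

Definition unique_r_path_lifting : Prop :=
  forall v e, hom0 f v = rng e -> exists! x, rng x = v /\ hom1 f x = e.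

Definition unique_s_path_lifting : Prop :=
  forall v e, hom0 f v = src e -> exists! x, src x = v /\ hom1 f x = e.

End PathLifting.

(* [f2 \o f1 = f4 \o f3] as graph homomorphisms *)
Definition ghom_square (A B C D : digraph)
    (f1 : ghom A B) (f2 : ghom B D) (f3 : ghom A C) (f4 : ghom C D) : Prop :=
  (forall x, hom0 f2 (hom0 f1 x) = hom0 f4 (hom0 f3 x)) /\
  (forall x, hom1 f2 (hom1 f1 x) = hom1 f4 (hom1 f3 x)).

(* The commutative square of sets with [f : A -> B], [g : A -> C],
   [h : B -> D], [k : C -> D] has the universal property of a pullback. *)
Definition is_pullback (A B C D : Type)
    (f : A -> B) (g : A -> C) (h : B -> D) (k : C -> D) : Prop :=
  h \o f =1 k \o g /\
  forall (X : Type) (u : X -> B) (v : X -> C), h \o u =1 k \o v ->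
    exists! w : X -> A, f \o w =1 u /\ g \o w =1 v.

Record textile := Textile {
  gG : digraph; gF1 : digraph; gF2 : digraph; gE : digraph;
  p1 : ghom gG gF1; q1 : ghom gG gF1;
  p2 : ghom gG gF2; q2 : ghom gG gF2;
  g1 : ghom gF1 gE; h1 : ghom gF1 gE;
  g2 : ghom gF2 gE; h2 : ghom gF2 gE;
  textile_gp : ghom_square p1 g1 p2 g2;
  textile_hq : ghom_square q1 h1 q2 h2;
  textile_gq : ghom_square q1 g1 p2 h2;
  textile_hp : ghom_square p1 h1 q2 g2;
  textile_injG1 : injective (fun x : edge gG =>
    (src x, rng x, hom1 p1 x, hom1 q1 x, hom1 p2 x, hom1 q2 x));
  textile_injG0 : injective (fun x : vertex gG =>
    (hom0 p1 x, hom0 q1 x, hom0 p2 x, hom0 q2 x));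
  textile_injF1 : injective (fun x : edge gF1 =>
    (src x, rng x, hom1 g1 x, hom1 h1 x));
  textile_injF2 : injective (fun x : edge gF2 =>
    (src x, rng x, hom1 g2 x, hom1 h2 x))
}.

Section TextileHomology.
Variable T : textile.

Definition textile_basis (n : nat) : choiceType :=
  match n with
  | 0 => vertex (gE T)
  | 1 => (vertex (gF1 T) + vertex (gF2 T) + edge (gE T))%type
  | 2 => (vertex (gG T) + edge (gF1 T) + edge (gF2 T))%type
  | 3 => edge (gG T)
  | _ => void
  end.

Definition textile_bnd1 (x : textile_basis 1) : {freeg (textile_basis 0)} :=
  match x with
  | inl (inl x) => << hom0 (h1 T) x >> - << hom0 (g1 T) x >>
  | inl (inr x) => << hom0 (h2 T) x >> - << hom0 (g2 T) x >>
  | inr x => << rng x >> - << src x >>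
  end.

Definition ofF1 (x : vertex (gF1 T)) : textile_basis 1 := inl (inl x).
Definition ofF2 (x : vertex (gF2 T)) : textile_basis 1 := inl (inr x).
Definition ofE (x : edge (gE T)) : textile_basis 1 := inr x.

Definition textile_bnd2 (x : textile_basis 2) : {freeg (textile_basis 1)} :=
  match x with
  | inl (inl x) => << ofF2 (hom0 (p2 T) x) >> + << ofF1 (hom0 (q1 T) x) >>
                   - << ofF1 (hom0 (p1 T) x) >> - << ofF2 (hom0 (q2 T) x) >>
  | inl (inr x) => << ofF1 (src x) >> + << ofE (hom1 (h1 T) x) >>
                   - << ofE (hom1 (g1 T) x) >> - << ofF1 (rng x) >>
  | inr x => << ofF2 (src x) >> + << ofE (hom1 (h2 T) x) >>
             - << ofE (hom1 (g2 T) x) >> - << ofF2 (rng x) >>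
  end.

Definition ofG0 (x : vertex (gG T)) : textile_basis 2 := inl (inl x).
Definition ofF1e (x : edge (gF1 T)) : textile_basis 2 := inl (inr x).
Definition ofF2e (x : edge (gF2 T)) : textile_basis 2 := inr x.

Definition textile_bnd3 (x : textile_basis 3) : {freeg (textile_basis 2)} :=
  << ofG0 (rng x) >> + << ofF2e (hom1 (p2 T) x) >>
  + << ofF1e (hom1 (q1 T) x) >> - << ofG0 (src x) >>
  - << ofF1e (hom1 (p1 T) x) >> - << ofF2e (hom1 (q2 T) x) >>.

Definition textile_bnd (n : nat) :
    textile_basis n.+1 -> {freeg (textile_basis n)} :=
  match n with
  | 0 => textile_bnd1
  | 1 => textile_bnd2
  | 2 => textile_bnd3
  | _ => fun _ => 0
  end.

Lemma textile_bnd_bnd n (x : textile_basis n.+2) :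
  free_bnd textile_bnd (textile_bnd x) = 0.
Proof.
have [gp gp'] := textile_gp T; have [hq hq'] := textile_hq T.
have [gq gq'] := textile_gq T; have [hp hp'] := textile_hp T.
case: n x => [|[|n]] x; last by rewrite raddf0.
  case: x => [[x|x]|x] /=; rewrite !raddfB !raddfD /= !free_bndU /=;
    rewrite ?(hom_src, hom_rng) ?gp ?hq ?gq ?hp; apply/eqP/freeg_eqP => z;
    rewrite !(coeffB, coeffD, coeff0); lia.
rewrite /= /textile_bnd3 !raddfB !raddfD /= !free_bndU /=.
rewrite !(hom_src, hom_rng) gp' hq' gq' hp'; apply/eqP/freeg_eqP => z.
rewrite !(coeffB, coeffD, coeff0); lia.
Qed.

Definition textile_complex : chain_complex := free_complex textile_bnd_bnd.

End TextileHomology.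

(* A small category presented by its morphisms: [comp a b] is the composite
   $a b$, meaningful only when [dom a = cod b]; its value on other pairs is
   irrelevant. *)
Record category := Category {
  obj : choiceType;
  mor : choiceType;
  cod : mor -> obj;
  dom : mor -> obj;
  idm : obj -> mor;
  comp : mor -> mor -> mor;
  cod_idm : forall v, cod (idm v) = v;
  dom_idm : forall v, dom (idm v) = v;
  cod_comp : forall a b, dom a = cod b -> cod (comp a b) = cod a;
  dom_comp : forall a b, dom a = cod b -> dom (comp a b) = dom b;
  comp_idl : forall a, comp (idm (cod a)) a = a;
  comp_idr : forall a, comp a (idm (dom a)) = a;
  compA : forall a b c, dom a = cod b -> dom b = cod c ->
    comp a (comp b c) = comp (comp a b) c
}.

Notation degree k := {ffun 'I_k -> nat}.

Definition unit_deg k (i : 'I_k) : degree k := [ffun j => (j == i) : nat].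
Definition deg_sub k (m n : degree k) : degree k :=
  [ffun i => (m i - n i)%N].

Definition is_degree_functor k (L : category) (d : mor L -> degree k) : Prop :=
  (forall v, d (idm v) = 0) /\
  (forall a b, dom a = cod b -> d (comp a b) = d a + d b).

Definition unique_factorization k (L : category) (d : mor L -> degree k) :
    Prop :=
  forall (l : mor L) (n m : degree k), d l = n + m ->
    exists! ab : mor L * mor L, [/\ dom ab.1 = cod ab.2,
      comp ab.1 ab.2 = l, d ab.1 = n & d ab.2 = m].

Definition is_kgraph k (L : category) (d : mor L -> degree k) : Prop :=
  is_degree_functor d /\ unique_factorization d.

Record kgraph (k : nat) := KGraph {
  kcat :> category;
  deg : mor kcat -> degree k;
  kgraphP : is_kgraph deg
}.

Section KGraphHomology.
Variables (k : nat) (L : kgraph k).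
Implicit Types (l x y z a b : mor L) (n m : degree k) (i j : 'I_k).

Local Notation d := (@deg k L).

Definition is_segment l n m x : Prop :=
  exists a b, [/\ dom a = cod x, dom x = cod b,
    comp (comp a x) b = l, d a = n & d b = deg_sub (d l) m].

(* $\lambda(n,m)$, for $n \le m \le d(\lambda)$ (see [segmentP]); the default
   value of [xget] is never used in that range. *)
Definition segment l n m : mor L := xget l (is_segment l n m).

Lemma deg_comp a b : dom a = cod b -> d (comp a b) = d a + d b.
Proof. by have [[_ +] _] := kgraphP L; apply. Qed.

Lemma factor_uniq a b a' b' : dom a = cod b -> dom a' = cod b' ->
  comp a b = comp a' b' -> d a = d a' -> a = a' /\ b = b'.
Proof.
move=> ab ab' e da; have [_ F] := kgraphP L.
have db : d b = d b'.
  have := congr1 d e; rewrite !deg_comp // da => /ffunP E.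
  by apply/ffunP => i; have := E i; rewrite !ffunE => /addnI.
have [[u v] [_ U]] := F _ _ _ (deg_comp ab).
have E1 := U (a, b) (And4 ab erefl erefl erefl).
have E2 := U (a', b') (And4 ab' (esym e) (esym da) (esym db)).
by move: E1; rewrite E2 => -[-> ->].
Qed.

Lemma deg_segment_aux l n m x : (forall i, m i <= d l i)%N ->
  is_segment l n m x -> d x = deg_sub m n.
Proof.
move=> ml [a [b [ax xb e da db]]].
have axb : dom (comp a x) = cod b by rewrite dom_comp.
have := congr1 d e; rewrite deg_comp // deg_comp // da db => /ffunP E.
apply/ffunP => i; have := E i; have := ml i; rewrite !ffunE.
rewrite -!/(addn _ _) /GRing.add /=; lia.
Qed.

Lemma segmentP l n m :
  (forall i, n i <= m i)%N -> (forall i, m i <= d l i)%N ->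
  is_segment l n m (segment l n m) /\
  (forall x, is_segment l n m x -> x = segment l n m).
Proof.
move=> nm ml; have [_ F] := kgraphP L.
have ex : is_segment l n m (segment l n m).
  apply: (@xgetPex _ l (is_segment l n m)).
  have [|[a c] [[/= ac e da dc] _]] := F l n (deg_sub (d l) n).
    apply/ffunP => i; rewrite !ffunE; have := nm i; have := ml i.
    rewrite /GRing.add /=; lia.
  have [|[x b] [[/= xb e' dx db] _]] := F c (deg_sub m n) (deg_sub (d l) m).
    apply/ffunP => i; rewrite dc !ffunE; have := nm i; have := ml i.
    rewrite /GRing.add /=; lia.
  have ax : dom a = cod x by rewrite ac -e' cod_comp.
  exists x, a, b; split=> //.
  by rewrite -compA // e' e.
split=> // x sx.
have dx := deg_segment_aux ml sx; have dy := deg_segment_aux ml ex.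
move: (segment l n m) ex dy => y [a' [b' [ay yb e' da' db']]] dy.
move: sx => [a [b [ax xb e da db]]].
have h1 : dom a = cod (comp x b) by rewrite cod_comp.
have h2 : dom a' = cod (comp y b') by rewrite cod_comp.
have [||_ E] := factor_uniq h1 h2; rewrite ?compA ?da ?e ?e' //.
by have [|] := factor_uniq xb yb E; rewrite ?dx.
Qed.

Definition is_cube (r : nat) : pred (mor L) :=
  fun l => [forall i, (d l i <= 1)%N] && (\sum_i d l i == r)%N.

Definition cube (r : nat) : choiceType := {l : mor L | is_cube r l}.

(* When $d(\lambda) = e_{i_1} + \dots + e_{i_n}$ with $i_1 < \dots < i_n$, the
   set [dirs l] is $\{i_1, \dots, i_n\}$ and [enum_val], which enumerates
   ordinals increasingly, sends [t : 'I_n] to $i_{t+1}$. *)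
Definition dirs l : pred 'I_k := fun i => d l i == 1%N.

(* [face s i l] is $F^s_t(\lambda)$ for $i_t$ = [i]. *)
Definition face (s : bool) i l : mor L :=
  if s then segment l (unit_deg i) (d l)
  else segment l 0 (deg_sub (d l) (unit_deg i)).

Lemma faceP s i l : i \in dirs l ->
  let n := if s then unit_deg i else 0 in
  let m := if s then d l else deg_sub (d l) (unit_deg i) in
  [/\ face s i l = segment l n m,
      (forall j, (n j <= m j)%N) & (forall j, (m j <= d l j)%N)].
Proof.
rewrite /in_mem /= /dirs => /eqP li; rewrite /face; case: s; split=> // j;
  rewrite !ffunE ?leq_subr //.
by case: eqP => [->|//]; rewrite li.
Qed.

Lemma deg_face s i l : i \in dirs l -> d (face s i l) = deg_sub (d l) (unit_deg i).
Proof.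
move=> il; have [-> nm ml] := faceP s il.
rewrite (deg_segment_aux ml (segmentP nm ml).1).
by apply/ffunP => j; rewrite !ffunE; case: s {nm ml}; rewrite !ffunE //= subn0.
Qed.

Lemma is_cube_face r l s i :
  is_cube r.+1 l -> i \in dirs l -> is_cube r (face s i l).
Proof.
move=> /andP[/forallP l1 /eqP ls] il; rewrite /is_cube deg_face //.
apply/andP; split.
  by apply/forallP => j; rewrite !ffunE (leq_trans (leq_subr _ _)).
have li : d l i = 1%N by apply/eqP.
move: ls; rewrite (bigD1 i) //= [X in _ -> X == _](bigD1 i) //= !ffunE eqxx li.
rewrite add1n => -[<-]; rewrite add0n; apply/eqP; apply: eq_bigr => j ji.
by rewrite !ffunE (negPf ji) subn0.
Qed.

Definition cube_face r (x : cube r.+1) (s : bool) (t : 'I_#|dirs (val x)|) :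
    cube r :=
  Sub (face s (enum_val t) (val x)) (is_cube_face s (valP x) (enum_valP t)).

(* The sign is $(-1)^{t+l}$, with $t$ counted from 1 and with [s] for $l$.
   There are no cubes of dimension above [k], so the boundary maps in degrees
   above [k] vanish. *)
Definition cube_bnd r (x : cube r.+1) : {freeg (cube r)} :=
  \sum_(s : bool) \sum_(t < #|dirs (val x)|)
    (-1) ^+ (t.+1 + s) *: << cube_face s t >>.

Definition cgen r l : {freeg (cube r)} :=
  if insub l is Some c then << c >> else 0.

Definition rank l i : nat := #|[pred j : 'I_k | dirs l j & (j < i)%N]|.

Lemma enum_val_mono (A : pred 'I_k) (s t : 'I_#|A|) :
  (enum_val s < enum_val t)%N = (s < t)%N.
Proof.
have H (u v : 'I_#|A|) : (u < v)%N -> (enum_val u < enum_val v)%N.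
  move=> uv; have x0 := enum_val u; rewrite !(enum_val_nth x0).
  have tr : transitive (relpre (@nat_of_ord k) ltn) by move=> ? ? ?; apply: ltn_trans.
  have S : sorted (relpre (@nat_of_ord k) ltn) (enum A).
    rewrite {1}/enum_mem sorted_filter // -enumT -sorted_map val_enum_ord.
    exact: iota_ltn_sorted.
  by apply: (sorted_ltn_nth tr) => //; rewrite inE -cardE.
case: (ltngtP s t) => [/H //|/H|/val_inj ->]; last by rewrite ltnn.
by move=> /ltnW; rewrite leqNgt => /negbTE ->.
Qed.

Lemma rank_enum_val l (t : 'I_#|dirs l|) : rank l (enum_val t) = t.
Proof.
rewrite /rank -[RHS](card_ord t).
have le : (t <= #|dirs l|)%N by apply: ltnW.
rewrite -(card_codom (f := fun u : 'I_t => enum_val (widen_ord le u))); last first.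
  by move=> u v /enum_val_inj /(congr1 val) /= /val_inj.
apply: eq_card => j; rewrite !inE; apply/andP/codomP => [[jl jt]|[u ->]].
  have jA : j \in dirs l by [].
  have /= := enum_val_mono (enum_rank_in jA j) t.
  rewrite enum_rankK_in // jt => /esym ut.
  exists (Ordinal ut); rewrite -[LHS](enum_rankK_in jA jA).
  by congr enum_val; apply: val_inj.
by split; [exact: (enum_valP (widen_ord le u)) | rewrite enum_val_mono /=].
Qed.

Lemma cube_bndE r (x : cube r.+1) : cube_bnd x =
  \sum_(s : bool) \sum_(i in dirs (val x))
    (-1) ^+ ((rank (val x) i).+1 + s) *: cgen r (face s i (val x)).
Proof.
apply: eq_bigr => s _; rewrite [RHS]big_enum_val; apply: eq_bigr => t _.
rewrite rank_enum_val /cgen; congr (_ *: _).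
case: insubP => [u _ eu|]; last by rewrite (is_cube_face s (valP x) (enum_valP t)).
by congr << _ >>; apply: val_inj; rewrite eu.
Qed.

Lemma segment_trans l n m x n' m' y :
  (forall i, n i <= m i)%N -> (forall i, m i <= d l i)%N ->
  (forall i, n' i <= m' i)%N -> (forall i, m' i <= d x i)%N ->
  is_segment l n m x -> is_segment x n' m' y -> is_segment l (n + n') (n + m') y.
Proof.
move=> nm ml nm' mx sx sy; have dx := deg_segment_aux ml sx.
case: sx sy => a [b [ax xb e da db]] [a' [b' [ay yb e' da' db']]].
have ayb : dom (comp a' y) = cod b' by rewrite dom_comp.
have aa' : dom a = cod a'.
  by rewrite ax -e' !cod_comp.
have bb : dom b' = cod b by rewrite -xb -e' dom_comp.
exists (comp a a'), (comp b' b); split.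
- by rewrite dom_comp.
- by rewrite cod_comp.
- have h : dom y = cod (comp b' b) by rewrite cod_comp.
  have h' : dom a' = cod (comp y (comp b' b)) by rewrite cod_comp.
  have -> : comp (comp (comp a a') y) (comp b' b) =
            comp a (comp (comp (comp a' y) b') b).
    by rewrite -(compA (a := comp a' y)) // -(compA (a := a')) //
       -(compA (a := comp a a')) ?dom_comp // -compA.
  by rewrite e' compA.
- by rewrite deg_comp // da da'.
- rewrite deg_comp // db db' dx; apply/ffunP => i; rewrite !ffunE.
  have := nm i; have := ml i; have := nm' i; have := mx i.
  rewrite dx !ffunE /GRing.add /=; lia.
Qed.

Lemma dirs_face s i l j : i \in dirs l ->
  dirs (face s i l) j = (j != i) && dirs l j.
Proof.
move=> il; rewrite /dirs deg_face // !ffunE.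
by have := il; rewrite /in_mem /= /dirs; case: (j =P i) => [->|] /=; lia.
Qed.

Lemma face_face s t i j l : i \in dirs l -> j \in dirs l -> i != j ->
  face t j (face s i l) = face s i (face t j l).
Proof.
have H (s' t' : bool) i' j' : i' \in dirs l -> j' \in dirs l -> i' != j' ->
    let e (c : bool) i := if c then unit_deg i else 0 in
    let f (c : bool) i := if c then 0 else unit_deg i in
    face t' j' (face s' i' l) = segment l (e s' i' + e t' j')
      (deg_sub (d l) (f s' i' + f t' j')).
  move=> il jl ij e f.
  have jx : j' \in dirs (face s' i' l).
    by rewrite /in_mem /= dirs_face // eq_sym ij.
  have [E1 nm ml] := faceP s' il; have [E2 nm' ml'] := faceP t' jx.
  have [S1 _] := segmentP nm ml; have [S2 _] := segmentP nm' ml'.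
  rewrite -E1 in S1; rewrite -E2 in S2.
  have S := segment_trans nm ml nm' ml' S1 S2.
  have key u : ((u == i') + (u == j') <= d l u)%N.
    case: (u =P i') => [->|_]; last by case: (u =P j') => [->|//]; rewrite (eqP jl).
    by rewrite (negPf ij) (eqP il).
  have [||_ U] := @segmentP l (e s' i' + e t' j')
    (deg_sub (d l) (f s' i' + f t' j')).
  - move=> u; have := key u; rewrite /e /f.
    case: (s') (t') => [] []; rewrite !ffunE /GRing.add /= ?ffunE;
      case: (u == i'); case: (u == j') => /=; lia.
  - by move=> u; rewrite !ffunE leq_subr.
  apply: U; move: S; congr is_segment.
  apply/ffunP => u; have := key u; rewrite /e /f.
  case: (s') (t') il => [] [] il; rewrite ?deg_face // !ffunE /GRing.add /= ?ffunE;
    case: (u == i'); case: (u == j') => /=; lia.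
move=> il jl ij; rewrite !H // 1?eq_sym //.
by congr (segment _ _ (deg_sub _ _)); rewrite addrC.
Qed.

Lemma rank_face s i l j : i \in dirs l ->
  rank l j = ((i < j) + rank (face s i l) j)%N.
Proof.
move=> il; rewrite /rank (cardD1 i) !inE; congr (_ + _)%N.
  by have -> : dirs l i = true by [].
by apply: eq_card => u; rewrite !inE dirs_face // andbA.
Qed.

Lemma cube_bnd_bnd r (x : cube r.+2) : free_bnd cube_bnd (cube_bnd x) = 0.
Proof.
pose l := val x.
pose T (p q : bool * 'I_k) : {freeg (cube r)} :=
  if [&& p.2 \in dirs l, q.2 \in dirs l & p.2 != q.2] then
    (-1) ^+ ((rank l p.2).+1 + p.1 + ((rank (face p.1 p.2 l) q.2).+1 + q.1)) *:
    cgen r (face q.1 q.2 (face p.1 p.2 l))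
  else 0.
have -> : free_bnd cube_bnd (cube_bnd x) = \sum_p \sum_q T p q.
  rewrite cube_bndE pair_big_dep /= big_mkcond /= raddf_sum.
  apply: eq_bigr => -[s i] _ /=.
  case: ifP => [il|il]; last first.
    by rewrite raddf0 big1 // => q _; rewrite /T /= il.
  rewrite raddfZsign /cgen.
  have C := is_cube_face s (valP x) il.
  case: insubP => [u _ eu|]; last by rewrite C.
  rewrite /= free_bndU cube_bndE eu pair_big_dep /= big_mkcond /= scaler_sumr.
  apply: eq_bigr => -[t j] _ /=.
  rewrite /T /= il eq_sym [j \in dirs (face _ _ _)]dirs_face // andbC.
  by case: ifP => _; rewrite ?scaler0 // scalerA -exprD.
have N p q : T p q = - T q p.
  rewrite /T andbCA [in RHS]eq_sym; case: ifP => [/and3P[ql pl pq]|]; last by rewrite oppr0.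
  rewrite face_face // -scaleNr; congr (_ *: _).
  have Rp := rank_face p.1 q.2 pl; have Rq := rank_face q.1 p.2 ql.
  rewrite -[RHS]mulN1r -exprS; apply/eqP; rewrite -signr_odd -[X in _ == X]signr_odd; apply/eqP.
  congr (_ ^+ nat_of_bool _); move: Rp Rq; move: pq; rewrite neq_ltn.
  have as_lt (u v : nat) : (u < v)%N -> (v < u)%N = false.
    by move=> /ltnW; rewrite leqNgt => /negbTE.
  case/orP=> pq; rewrite (as_lt _ _ pq) pq => Rp Rq; lia.
set S := \sum_p _.
have : S = - S.
  rewrite {2}/S exchange_big /= -sumrN; apply: eq_bigr => p _.
  by rewrite -sumrN; apply: eq_bigr => q _; rewrite N.
move=> SN; apply/eqP/freeg_eqP => z; have := congr1 (coeff z) SN.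
rewrite coeffN coeff0; lia.
Qed.

Definition kgraph_complex : chain_complex := free_complex cube_bnd_bnd.

End KGraphHomology.

Section PathCategory.
Variable D : digraph.

(* The pair [(v, [:: x_1; ...; x_n])] encodes the path $x_1 \cdots x_n$ with
   initial vertex [v]; it satisfies $r(x_i) = s(x_{i+1})$. *)
Fixpoint is_path (v : vertex D) (s : seq (edge D)) : bool :=
  if s is x :: s' then (src x == v) && is_path (rng x) s' else true.

Fixpoint path_end (v : vertex D) (s : seq (edge D)) : vertex D :=
  if s is x :: s' then path_end (rng x) s' else v.

Definition dpath : choiceType :=
  {p : vertex D * seq (edge D) | is_path p.1 p.2}.

Definition path_cod (p : dpath) : vertex D := (val p).1.
Definition path_dom (p : dpath) : vertex D := path_end (val p).1 (val p).2.

Definition path_id (v : vertex D) : dpath := exist _ (v, [::]) isT.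

Definition path_comp (p q : dpath) : dpath :=
  insubd p ((val p).1, (val p).2 ++ (val q).2).

Lemma is_path_cat v s t :
  is_path v (s ++ t) = is_path v s && is_path (path_end v s) t.
Proof. by elim: s v => //= x s IH v; rewrite IH andbA. Qed.

Lemma path_end_cat v s t :
  path_end v (s ++ t) = path_end (path_end v s) t.
Proof. by elim: s v => //=. Qed.

Lemma val_path_comp p q : path_dom p = path_cod q ->
  val (path_comp p q) = ((val p).1, (val p).2 ++ (val q).2).
Proof.
move=> pq; rewrite val_insubd /= is_path_cat (valP p) /=.
by move: pq; rewrite /path_dom => ->; rewrite (valP q).
Qed.

Lemma path_cod_comp p q :
  path_dom p = path_cod q -> path_cod (path_comp p q) = path_cod p.
Proof. by move=> pq; rewrite /path_cod val_path_comp. Qed.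

Lemma path_dom_comp p q :
  path_dom p = path_cod q -> path_dom (path_comp p q) = path_dom q.
Proof.
move=> pq; rewrite /path_dom val_path_comp //= path_end_cat.
by move: pq; rewrite /path_dom => ->.
Qed.

Lemma path_comp_idl p : path_comp (path_id (path_cod p)) p = p.
Proof.
by apply: val_inj; rewrite val_path_comp //=; case: p => -[].
Qed.

Lemma path_comp_idr p : path_comp p (path_id (path_dom p)) = p.
Proof.
by apply: val_inj; rewrite val_path_comp //= cats0; case: p => -[].
Qed.

Lemma path_compA p q r : path_dom p = path_cod q -> path_dom q = path_cod r ->
  path_comp p (path_comp q r) = path_comp (path_comp p q) r.
Proof.
move=> pq qr; apply: val_inj.
rewrite !val_path_comp ?path_dom_comp ?path_cod_comp //=.
by rewrite catA.
Qed.

Definition path_category : category := @Category (vertex D) dpath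
  path_cod path_dom path_id path_comp
  (fun _ => erefl) (fun _ => erefl) path_cod_comp path_dom_comp
  path_comp_idl path_comp_idr path_compA.

Definition edge_path (x : edge D) : mor path_category :=
  insubd (path_id (src x)) (src x, [:: x]).

End PathCategory.

Definition parallel (C : category) (a b : mor C) : Prop :=
  cod a = cod b /\ dom a = dom b.

Record congruence (C : category) := Congruence {
  crel :> mor C -> mor C -> Prop;
  cong_parallel : forall a b, crel a b -> parallel a b;
  cong_refl : forall a, crel a a;
  cong_sym : forall a b, crel a b -> crel b a;
  cong_trans : forall a b c, crel a b -> crel b c -> crel a c;
  cong_comp : forall a a' b b', crel a a' -> crel b b' ->
    dom a = cod b -> crel (comp a b) (comp a' b')
}.

(* For [R] relating parallel morphisms this is the smallest congruence
   containing [R]: see [generated_congruence] and [generated_smallest]. *)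
Inductive generated (C : category) (R : mor C -> mor C -> Prop) :
    mor C -> mor C -> Prop :=
| gen_rel a b : R a b -> generated R a b
| gen_refl a : generated R a a
| gen_sym a b : generated R a b -> generated R b a
| gen_trans a b c : generated R a b -> generated R b c -> generated R a c
| gen_comp a a' b b' : generated R a a' -> generated R b b' ->
    dom a = cod b -> dom a' = cod b' -> generated R (comp a b) (comp a' b').

Section Generated.
Variables (C : category) (R : mor C -> mor C -> Prop).
Hypothesis R_parallel : forall a b, R a b -> parallel a b.

Lemma generated_parallel a b : generated R a b -> parallel a b.
Proof.
rewrite /parallel; elim=> {a b} [a b /R_parallel|a|a b _ []|a b c _ [-> ->] _|
  a a' b b' _ [ca da] _ [cb db] ab ab'] //.
by rewrite !cod_comp // !dom_comp.
Qed.

Lemma generated_comp a a' b b' : generated R a a' -> generated R b b' ->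
  dom a = cod b -> generated R (comp a b) (comp a' b').
Proof.
move=> aa bb ab; apply: gen_comp => //.
have [_ <-] := generated_parallel aa.
by have [<- _] := generated_parallel bb.
Qed.

Definition generated_congruence : congruence C :=
  Congruence generated_parallel (@gen_refl C R) (@gen_sym C R)
    (@gen_trans C R) generated_comp.

Lemma generated_smallest (S : congruence C) :
  (forall a b, R a b -> S a b) -> forall a b, generated_congruence a b -> S a b.
Proof.
move=> RS a b; elim=> {a b} [a b /RS|a|a b _|a b c _ ab _|a a' b b' _ ? _ ? ? _] //.
- exact: cong_refl.
- exact: cong_sym.
- exact: cong_trans ab.
- exact: cong_comp.
Qed.

End Generated.

Section QuotientCategory.
Variables (C : category) (S : congruence C).

Definition cong_rel : rel (mor C) := fun a b => `[< S a b >].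

Lemma cong_rel_refl : reflexive cong_rel.
Proof. by move=> a; apply/asboolP/cong_refl. Qed.
Lemma cong_rel_sym : symmetric cong_rel.
Proof. by move=> a b; apply/asboolP/asboolP => /cong_sym. Qed.
Lemma cong_rel_trans : transitive cong_rel.
Proof.
by move=> b a c /asboolP ab /asboolP bc; apply/asboolP; apply: cong_trans bc.
Qed.

Canonical cong_equiv :=
  EquivRel cong_rel cong_rel_refl cong_rel_sym cong_rel_trans.

Definition quot_mor : choiceType := {eq_quot cong_rel}.

Definition quot_class (a : mor C) : quot_mor := \pi_{eq_quot cong_rel} a.

Lemma quot_classP a b : quot_class a = quot_class b <-> S a b.
Proof.
split=> [/eqmodP/asboolP //|ab]; apply/eqmodP; exact/asboolP.
Qed.

Lemma repr_quot_class a : S (repr (quot_class a)) a.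
Proof. by apply/quot_classP; rewrite /quot_class reprK. Qed.

Lemma quot_class_repr (x : quot_mor) : quot_class (repr x) = x.
Proof. exact: reprK. Qed.

Definition quot_cod (x : quot_mor) : obj C := cod (repr x).
Definition quot_dom (x : quot_mor) : obj C := dom (repr x).
Definition quot_id (v : obj C) : quot_mor := quot_class (idm v).
Definition quot_comp (x y : quot_mor) : quot_mor :=
  quot_class (comp (repr x) (repr y)).

Lemma quot_cod_class a : quot_cod (quot_class a) = cod a.
Proof. by have [] := cong_parallel (repr_quot_class a). Qed.

Lemma quot_dom_class a : quot_dom (quot_class a) = dom a.
Proof. by have [] := cong_parallel (repr_quot_class a). Qed.

Lemma quot_comp_class a b : dom a = cod b ->
  quot_comp (quot_class a) (quot_class b) = quot_class (comp a b).
Proof.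
move=> ab; apply/quot_classP; apply: cong_comp; try exact: repr_quot_class.
by rewrite -/(quot_dom _) -/(quot_cod _) quot_dom_class quot_cod_class.
Qed.

Fact quot_cod_id v : quot_cod (quot_id v) = v.
Proof. by rewrite quot_cod_class cod_idm. Qed.
Fact quot_dom_id v : quot_dom (quot_id v) = v.
Proof. by rewrite quot_dom_class dom_idm. Qed.
Fact quot_cod_comp x y :
  quot_dom x = quot_cod y -> quot_cod (quot_comp x y) = quot_cod x.
Proof. by move=> xy; rewrite quot_cod_class cod_comp. Qed.
Fact quot_dom_comp x y :
  quot_dom x = quot_cod y -> quot_dom (quot_comp x y) = quot_dom y.
Proof. by move=> xy; rewrite quot_dom_class dom_comp. Qed.
Fact quot_comp_idl x : quot_comp (quot_id (quot_cod x)) x = x.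
Proof.
rewrite -{2}(quot_class_repr x) quot_comp_class ?dom_idm // comp_idl.
exact: quot_class_repr.
Qed.
Fact quot_comp_idr x : quot_comp x (quot_id (quot_dom x)) = x.
Proof.
rewrite -{1}(quot_class_repr x) quot_comp_class ?cod_idm // comp_idr.
exact: quot_class_repr.
Qed.
Fact quot_compA x y z : quot_dom x = quot_cod y -> quot_dom y = quot_cod z ->
  quot_comp x (quot_comp y z) = quot_comp (quot_comp x y) z.
Proof.
move=> xy yz; rewrite -[in LHS](quot_class_repr x) -[in RHS](quot_class_repr z).
rewrite !quot_comp_class ?cod_comp ?dom_comp //.
by rewrite compA.
Qed.

Definition quotient_category : category := Category
  quot_cod_id quot_dom_id quot_cod_comp quot_dom_comp
  quot_comp_idl quot_comp_idr quot_compA.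

End QuotientCategory.

Section Lambda.
Variable T : textile.

(* The skeleton of [Lambda]. As in [textile_basis 1], the edges coming from
   [vertex (gF1 T)], [vertex (gF2 T)] and [edge (gE T)] are entered through
   [ofF1], [ofF2] and [ofE]. *)
Definition GT : digraph := @Digraph (vertex (gE T)) (textile_basis T 1)
  (fun x => match x with
            | inl (inl x) => hom0 (g1 T) x
            | inl (inr x) => hom0 (g2 T) x
            | inr x => src x
            end)
  (fun x => match x with
            | inl (inl x) => hom0 (h1 T) x
            | inl (inr x) => hom0 (h2 T) x
            | inr x => rng x
            end).

(* The colors $e_2$, $e_1$, $e_3$; ordinals count from 0. *)
Definition color (x : edge GT) : 'I_3 :=
  match x with
  | inl (inl _) => inord 1
  | inl (inr _) => inord 0
  | inr _ => inord 2
  end.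

Definition path_deg (p : mor (path_category GT)) : degree 3 :=
  \sum_(x <- (val p).2) unit_deg (color x).

Definition path2 (x y : edge GT) : mor (path_category GT) :=
  comp (edge_path x) (edge_path y).

Inductive textile_rel : mor (path_category GT) -> mor (path_category GT) -> Prop :=
| rel_G (x : vertex (gG T)) :
    textile_rel (path2 (ofF2 (hom0 (p2 T) x)) (ofF1 (hom0 (q1 T) x)))
                (path2 (ofF1 (hom0 (p1 T) x)) (ofF2 (hom0 (q2 T) x)))
| rel_F1 (x : edge (gF1 T)) :
    textile_rel (path2 (ofF1 (src x)) (ofE (hom1 (h1 T) x)))
                (path2 (ofE (hom1 (g1 T) x)) (ofF1 (rng x)))
| rel_F2 (x : edge (gF2 T)) :
    textile_rel (path2 (ofF2 (src x)) (ofE (hom1 (h2 T) x)))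
                (path2 (ofE (hom1 (g2 T) x)) (ofF2 (rng x))).

Lemma val_edge_path (x : edge GT) : val (edge_path x) = (src x, [:: x]).
Proof. by rewrite val_insubd /= eqxx. Qed.

Lemma val_path2 (x y : edge GT) : rng x = src y ->
  val (path2 x y) = (src x, [:: x; y]).
Proof.
by move=> xy; rewrite val_path_comp /= /path_dom /path_cod !val_edge_path.
Qed.

Lemma textile_relP a b : textile_rel a b ->
  parallel a b /\ path_deg a = path_deg b.
Proof.
have H (x y x' y' : edge GT) : rng x = src y -> rng x' = src y' ->
    src x = src x' -> rng y = rng y' -> [:: color x; color y] = [:: color y'; color x'] ->
    parallel (path2 x y) (path2 x' y') /\
    path_deg (path2 x y) = path_deg (path2 x' y').
  move=> xy xy' xx yy [cx cy]; rewrite /parallel /= /path_cod /path_dom /path_deg.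
  by rewrite !val_path2 //= !big_cons big_nil !addr0 cx cy addrC.
have [gp _] := textile_gp T; have [hq _] := textile_hq T.
have [gq _] := textile_gq T; have [hp _] := textile_hp T.
by case=> x; apply: H => //=; rewrite ?hom_src ?hom_rng.
Qed.

Definition textile_congruence : congruence (path_category GT) :=
  generated_congruence (fun a b ab => (@textile_relP a b ab).1).

Definition Lambda : category := quotient_category textile_congruence.

Definition Lambda_deg (x : mor Lambda) : degree 3 := path_deg (repr x).

Lemma path_deg_comp a b : dom a = cod b ->
  path_deg (comp a b) = path_deg a + path_deg b.
Proof. by move=> ab; rewrite /path_deg val_path_comp //= big_cat. Qed.

Lemma path_deg_congruence a b : textile_congruence a b -> path_deg a = path_deg b.
Proof.
elim=> {a b} [x y /textile_relP[]|x|x y _ ->|x y z _ -> _ ->|] //.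
by move=> x x' y y' _ xx _ yy xy xy'; rewrite !path_deg_comp // xx yy.
Qed.

Lemma Lambda_deg_class a :
  Lambda_deg (quot_class textile_congruence a) = path_deg a.
Proof. by apply: path_deg_congruence; apply: repr_quot_class. Qed.

Lemma Lambda_degree_functor : is_degree_functor Lambda_deg.
Proof.
split=> [v|x y xy]; first by rewrite Lambda_deg_class /path_deg big_nil.
by rewrite Lambda_deg_class path_deg_comp.
Qed.

End Lambda.

(* Main.v *)
(* A k-colored graph whose bicolored squares are unique in both directions
   and compatible around 3-colored cubes presents a k-graph: insertion sort by
   color, moving edges across squares, is invariant under square moves (this
   is where the cube condition enters), and on paths with a given color word it
   is injective.  So a class of paths contains exactly one path for each
   rearrangement of its color word, which is unique factorization.  For
   [Lambda], unique path lifting and the pullbacks provide the squares, and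
   [q1_lift] fills a path $F_2^0 F_1^0 E^1$ with some $z \in G^1$, whose faces
   give the cube condition.  Each cube of [Lambda] has a unique representative
   with increasing colors, and such paths are in bijection with the basis of
   the textile complex; the boundary maps then agree with no change of signs. *)
From HB Require Import structures.
From mathcomp Require Import all_boot all_order all_algebra.
From mathcomp Require Import ring_quotient freeg.
From mathcomp Require Import boolp classical_sets.
From mathcomp Require Import zify.
Require Import Defs.

Set Implicit Arguments.
Unset Strict Implicit.
Unset Printing Implicit Defensive.

Import GRing.Theory.
Local Open Scope ring_scope.
Local Open Scope quotient_scope.

(** * Free complexes and homology *)

Section FreeMap.
Variables (X Y : choiceType) (f : X -> Y).

Definition free_map (x : {freeg X}) : {freeg Y} :=
  fglift (fun x => << f x >>) x.

HB.instance Definition _ := GRing.isZmodMorphism.Build _ _ free_map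
  (@lift_is_additive int X _ (fun x => << f x >>)).

Lemma free_mapU x : free_map << x >> = << f x >>.
Proof. by rewrite /free_map liftU scale1r. Qed.

Lemma free_mapD : {morph free_map : x y / x + y}.
Proof. exact: raddfD. Qed.

Lemma free_mapB : {morph free_map : x y / x - y}.
Proof. exact: raddfB. Qed.

End FreeMap.

Lemma freeg_additive_ext (X : choiceType) (M : zmodType)
    (f g : {additive {freeg X} -> M}) :
  (forall x, f << x >> = g << x >>) -> f =1 g.
Proof.
move=> fg x; rewrite -[x]freeg_sumE !raddf_sum; apply: eq_bigr => z _.
(* Each term becomes an integer multiple of a generator, which every additive map preserves. *)
by rewrite -[coeff z x]intz -freegU_mulz !raddfMz fg.
Qed.

Lemma free_map_bij (X Y : choiceType) (f : X -> Y) :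
  bijective f -> bijective (free_map f).
Proof.
case=> g fK gK; exists (free_map g) => x.
(* [idfun] carries the additive structure that [freeg_additive_ext] asks of both sides. *)
- rewrite -[RHS]/(idfun x).
  apply: (@freeg_additive_ext _ _ (free_map g \o free_map f) idfun).
  by move=> y /=; rewrite !free_mapU fK.
- rewrite -[RHS]/(idfun x).
  apply: (@freeg_additive_ext _ _ (free_map f \o free_map g) idfun).
  by move=> y /=; rewrite !free_mapU gK.
Qed.

(** Both composites in a square of additive maps are determined by generators, so the comparison of
    complexes reduces to bases and the boundaries of their elements. *)
Lemma free_complex_iso (B B' : nat -> choiceType)
    (d : forall n, B n.+1 -> {freeg (B n)})
    (d' : forall n, B' n.+1 -> {freeg (B' n)})
    (dd : forall n (x : B n.+2), free_bnd d (d n.+1 x) = 0)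
    (dd' : forall n (x : B' n.+2), free_bnd d' (d' n.+1 x) = 0)
    (b : forall n, B n -> B' n) :
  (forall n, bijective (b n)) ->
  (forall n (x : B n.+1), free_map (b n) (d n x) = d' n (b n.+1 x)) ->
  complex_iso (free_complex dd) (free_complex dd').
Proof.
move=> bbij bd; exists (fun n => free_map (b n)).
split=> n; first exact/free_map_bij/bbij.
apply: (@freeg_additive_ext _ _ (free_map (b n) \o free_bnd d (n:=n))
   (free_bnd d' (n:=n) \o free_map (b n.+1))).
by move=> x /=; rewrite free_mapU !free_bndU bd.
Qed.

Lemma homology_eq0 (C : chain_complex) n (z : cycles C n) :
  \pi_(homology C n) z = 0 <-> exists y, bnd C n y = val z.
Proof.
have <- : \pi_(homology C n) 0 = 0 by rewrite raddf0.
split=> [/eqP|[y yz]]; last apply/eqP; rewrite -Quotient.idealrBE subr0.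
  by move/asboolP.
by apply/asboolP; exists y.
Qed.

(** * Functoriality of homology *)

Section HomologyIso.
Variables (C D : chain_complex) (phi : forall n, {additive C n -> D n}).
Hypothesis phi_bnd : forall n (x : C n.+1),
  phi n (bnd C n x) = bnd D n (phi n.+1 x).

Lemma is_cycle_map n (x : C n) : x \in @is_cycle C n ->
  phi n x \in @is_cycle D n.
Proof.
case: n x => [|n] x //; rewrite /in_mem /= => /eqP x0.
by rewrite -phi_bnd x0 raddf0.
Qed.

Definition cycle_map n (z : cycles C n) : cycles D n :=
  Sub (phi n (val z)) (is_cycle_map (valP z)).

Lemma cycle_mapB n : {morph @cycle_map n : x y / x - y}.
Proof. by move=> x y; apply: val_inj; rewrite /= raddfB. Qed.

(** Defined through a chosen representative cycle; [homology_mapE] removes the choice. *)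
Definition homology_map n (x : homology C n) : homology D n :=
  \pi_(homology D n) (cycle_map (repr x)).

(** Two representatives differ by some [bnd C n y], which [phi] sends to the boundary of
    [phi n.+1 y]. *)
Lemma homology_mapE n (z : cycles C n) :
  homology_map (\pi_(homology C n) z) = \pi_(homology D n) (cycle_map z).
Proof.
apply/eqP; rewrite /homology_map -Quotient.idealrBE -cycle_mapB.
have : repr (\pi_(homology C n) z) - z \in @is_boundary C n.
  by rewrite Quotient.idealrBE reprK.
move=> /asboolP[y yz]; apply/asboolP; exists (phi n.+1 y).
by rewrite -phi_bnd yz.
Qed.

Lemma homology_map_is_additive n : zmod_morphism (@homology_map n).
Proof.
move=> x y; rewrite -[x]reprK -[y]reprK -raddfB !homology_mapE /=.
by rewrite cycle_mapB raddfB.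
Qed.

HB.instance Definition _ n := GRing.isZmodMorphism.Build _ _ (@homology_map n)
  (@homology_map_is_additive n).

End HomologyIso.

Lemma inj_surj_bij (A B : Type) (f : A -> B) :
  injective f -> (forall y, exists x, f x = y) -> bijective f.
Proof.
move=> f_inj f_surj; pose g y := projT1 (cid (f_surj y)).
have gK y : f (g y) = y by apply: (projT2 (cid (f_surj y))).
by exists g => // x; apply: f_inj; rewrite gK.
Qed.

Lemma complex_iso_homology (C D : chain_complex) : complex_iso C D ->
  forall n, zmod_iso (homology C n) (homology D n).
Proof.
move=> [phi [phi_bij phi_bnd]] n; exists (homology_map phi_bnd (n := n)).
apply: inj_surj_bij => [|y].
  apply: raddf_inj => x.
  have -> : x = \pi_(homology C n) (repr x) by rewrite reprK.
  rewrite /= homology_mapE => /homology_eq0[y yx].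
  (* A chain bounding the image is pulled back one degree up; injectivity of [phi n] shows that it
     bounds [repr x]. *)
  have [g _ gK] := phi_bij n.+1.
  apply/homology_eq0; exists (g y); apply: (bij_inj (phi_bij n)).
  by rewrite phi_bnd gK.
have [g _ gK] := phi_bij n.
(* The preimage of a cycle is a cycle because [phi] is injective one degree lower; in degree 0 there
   is nothing to check. *)
have gy : g (val (repr y)) \in @is_cycle C n.
  case: n y g gK => [|n] y g gK //; rewrite /in_mem /=; apply/eqP.
  apply: (bij_inj (phi_bij n)); rewrite phi_bnd gK raddf0.
  by apply/eqP; apply: (valP (repr y)).
exists (\pi_(homology C n) (Cycle gy)).
rewrite /= homology_mapE -[RHS]reprK; congr (\pi_(homology D n) _).
by apply: val_inj; rewrite /= gK.
Qed.

(** * Colored graphs with complete squares *)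

Section ColoredGraph.
Variables (k : nat) (D : digraph) (color : edge D -> 'I_k).
Implicit Types (x y z : edge D) (s t u : seq (edge D)) (v : vertex D).

(* [sq x y y' x'] is the square $x y \sim y' x'$, with $x'$ opposite to $x$ and
   $y'$ opposite to $y$.  The cube condition need only be tested on paths with
   increasing colors, the ones that the sorting below rearranges. *)
Record complete_squares (sq : edge D -> edge D -> edge D -> edge D -> Prop) :
    Prop := CompleteSquares {
  sq_sym : forall x y y' x', sq x y y' x' -> sq y' x' x y;
  sq_color : forall x y y' x', sq x y y' x' ->
    [/\ color x' = color x, color y' = color y & color x != color y];
  sq_path : forall x y y' x', sq x y y' x' ->
    [/\ rng x = src y, rng y' = src x', src y' = src x & rng x' = rng y];
  sq_exists : forall x y, rng x = src y -> color x != color y ->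
    exists y' x', sq x y y' x';
  sq_uniq : forall x y y1 x1 y2 x2, sq x y y1 x1 -> sq x y y2 x2 ->
    y1 = y2 /\ x1 = x2;
  sq_cube : forall x y z y' x' z1 y1 z2 x1 z3 x3 z4 y4,
    (color x < color y)%N -> (color y < color z)%N ->
    sq x y y' x' -> sq y z z1 y1 -> sq x z1 z2 x1 ->
    sq x' z z3 x3 -> sq y' z3 z4 y4 -> z2 = z4 /\ sq x1 y1 y4 x3
}.

(** * Sorting paths by color *)

Variable sq : edge D -> edge D -> edge D -> edge D -> Prop.
Hypothesis sqP : complete_squares sq.

(** The default [(y, x)] is returned only when no square starts with [x y], which [sq_exists]
    excludes for composable edges of distinct colors. *)
Definition swap x y : edge D * edge D := xget (y, x) [set p | sq x y p.1 p.2].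

Lemma swap_sq x y : rng x = src y -> color x != color y ->
  sq x y (swap x y).1 (swap x y).2.
Proof.
move=> xy cxy; have [y' [x' h]] := sq_exists sqP xy cxy.
by apply: (@xgetPex _ (y, x) [set p | sq x y p.1 p.2]); exists (y', x').
Qed.

Lemma swapE x y y' x' : sq x y y' x' -> swap x y = (y', x').
Proof.
move=> h; have [xy _ _ _] := sq_path sqP h; have [_ _ c] := sq_color sqP h.
have [] := sq_uniq sqP (swap_sq xy c) h.
by case: (swap x y) => a b /= -> ->.
Qed.

(** Larger colors go to the front: [x] travels right across squares, which replace both edges, and
    stops before the first edge whose color is not larger. *)
Fixpoint insert x s : seq (edge D) :=
  if s is y :: s' then
    if (color x < color y)%N then (swap x y).1 :: insert (swap x y).2 s'
    else x :: s
  else [:: x].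

Definition normal s : seq (edge D) := foldr insert [::] s.

Lemma insert_path v x s : is_path v (x :: s) ->
  is_path v (insert x s) /\ path_end v (insert x s) = path_end v (x :: s).
Proof.
elim: s v x => [|y s IH] v x //= /and3P[/eqP xv /eqP xy ys].
case: ifP => [c|_] /=; last by rewrite xv xy ys !eqxx.
have c' : color x != color y by rewrite neq_ltn c.
have [_ p2 p3 p4] := sq_path sqP (swap_sq (esym xy) c').
have [|-> ->] := IH (rng (swap x y).1) (swap x y).2.
  by rewrite /= p2 eqxx p4.
by rewrite p3 xv eqxx /= p4.
Qed.

Lemma normal_path v s : is_path v s ->
  is_path v (normal s) /\ path_end v (normal s) = path_end v s.
Proof.
elim: s v => //= x s IH v /andP[/eqP xv xs]; have [h1 h2] := IH _ xs.
by have [|-> ->] := @insert_path v x (normal s); rewrite /= ?xv ?eqxx.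
Qed.

(** This is the invariance of sorting under a square move. The induction follows the head [z] of
    [s], and the cube condition is used when [z] must cross both edges. *)
Lemma insert_sq x y y' x' s : sq x y y' x' -> is_path (rng y) s ->
  insert x (insert y s) = insert y' (insert x' s).
Proof.
(* A square read backwards is a square, so the other order of colors is the same equation with its
   sides exchanged. *)
wlog: x y y' x' / (color x < color y)%N.
  move=> W h; have [c1 c2 c3] := sq_color sqP h.
  move: c3; rewrite neq_ltn => /orP[c|c]; first exact: (W _ _ _ _ c h).
  have [_ _ _ <-] := sq_path sqP h.
  by move=> ps; rewrite (W _ _ _ _ _ (sq_sym sqP h)) // c1 c2.
elim: s x y y' x' => [|z s IH] x y y' x' cxy h /=.
  have [c1 c2 c3] := sq_color sqP h.
  by rewrite c1 c2 cxy ltnNge ltnW //= (swapE h).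
have [p1 p2 p3 p4] := sq_path sqP h; have [c1 c2 c3] := sq_color sqP h.
move=> /andP[/eqP zy ps].
(* If [z] has the largest color, it crosses both edges on either side. [sq_cube] says that it
   arrives as the same edge and leaves behind a square, to which the induction hypothesis
   applies. *)
case: (ltnP (color y) (color z)) => [cyz|czy].
  have cxz : (color x < color z)%N by apply: ltn_trans cyz.
  rewrite c1 cxz.
  have hyz : sq y z (swap y z).1 (swap y z).2.
    by apply: swap_sq; rewrite // neq_ltn cyz.
  have [q1 q2 q3 q4] := sq_path sqP hyz; have [d1 d2 _] := sq_color sqP hyz.
  have hxz : sq x (swap y z).1 (swap x (swap y z).1).1 (swap x (swap y z).1).2.
    by apply: swap_sq; rewrite ?q3 // d2 neq_ltn cxz.
  have [e1 e2 _] := sq_color sqP hxz.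
  have hx'z : sq x' z (swap x' z).1 (swap x' z).2.
    by apply: swap_sq; rewrite ?p4 // c1 neq_ltn cxz.
  have [r1 r2 r3 r4] := sq_path sqP hx'z; have [f1 f2 _] := sq_color sqP hx'z.
  have hy'z : sq y' (swap x' z).1
      (swap y' (swap x' z).1).1 (swap y' (swap x' z).1).2.
    by apply: swap_sq; rewrite ?r3 // f2 c2 neq_ltn cyz.
  have [E S] := sq_cube sqP cxy cyz h hyz hxz hx'z hy'z.
  rewrite /= d2 f2 c2 cxz cyz E; congr (_ :: _).
  by apply: IH => //; rewrite ?q4 // e1 d1.
(* Here [y] stays before [z]: both sides begin with [y'], and only [x'] may still cross [z]. *)
rewrite [LHS]/= cxy (swapE h) /= c1.
case: ifP => cxz /=; last by rewrite c1 c2 ltnNge ltnW.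
have [||_ -> _] := sq_color sqP (@swap_sq x' z _ _); first by rewrite p4.
  by rewrite c1 neq_ltn cxz.
by rewrite c2 ltnNge czy.
Qed.

(** Equal color words force the same swaps on both sides. The tails of the results determine the
    edges that were pushed right, and each square, read backwards, determines the original pair. *)
Lemma insert_inj v v' x x' s s' :
  color x = color x' -> map color s = map color s' ->
  is_path v (x :: s) -> is_path v' (x' :: s') ->
  insert x s = insert x' s' -> x = x' /\ s = s'.
Proof.
elim: s s' v v' x x' => [|y s IH] [|y' s'] v v' x x' //=;
  first by move=> _ _ _ _ [].
move=> cx [cy cs] /and3P[_ /eqP xy ys] /and3P[_ /eqP xy' ys']; rewrite cx cy.
case: ifP => c; last by move=> [-> -> ->].
have h : sq x y (swap x y).1 (swap x y).2.
  by apply: swap_sq; rewrite // cx cy neq_ltn c.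
have h' : sq x' y' (swap x' y').1 (swap x' y').2.
  by apply: swap_sq; rewrite // neq_ltn c.
have [p1 p2 p3 p4] := sq_path sqP h; have [c1 _ _] := sq_color sqP h.
have [p1' p2' p3' p4'] := sq_path sqP h'; have [c1' _ _] := sq_color sqP h'.
have ps : is_path (rng (swap x y).1) ((swap x y).2 :: s).
  by rewrite /= p2 eqxx p4.
have ps' : is_path (rng (swap x' y').1) ((swap x' y').2 :: s').
  by rewrite /= p2' eqxx p4'.
have cc : color (swap x y).2 = color (swap x' y').2 by rewrite c1 c1'.
move=> [e1 e2]; have [e3 ->] := IH s' _ _ _ _ cc cs ps ps' e2.
by have := sq_sym sqP h;
  rewrite e1 e3 => /(sq_uniq sqP) /(_ (sq_sym sqP h')) [-> ->].
Qed.

(** Colors alone decide which swaps occur, and a square carries them across unchanged. [normal_inj]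
    uses this to compare the sorted tails. *)
Lemma color_insert v v' x x' s s' :
  color x = color x' -> map color s = map color s' ->
  is_path v (x :: s) -> is_path v' (x' :: s') ->
  map color (insert x s) = map color (insert x' s').
Proof.
elim: s s' v v' x x' => [|y s IH] [|y' s'] v v' x x' //=; first by move=> ->.
move=> cx [cy cs] /and3P[_ /eqP xy ys] /and3P[_ /eqP xy' ys']; rewrite cx cy.
case: ifP => c /=; last by rewrite cx cy cs.
have h : sq x y (swap x y).1 (swap x y).2.
  by apply: swap_sq; rewrite // cx cy neq_ltn c.
have h' : sq x' y' (swap x' y').1 (swap x' y').2.
  by apply: swap_sq; rewrite // neq_ltn c.
have [p1 p2 p3 p4] := sq_path sqP h; have [c1 c2 _] := sq_color sqP h.
have [p1' p2' p3' p4'] := sq_path sqP h'; have [c1' c2' _] := sq_color sqP h'.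
rewrite c2 c2' cy; congr (_ :: _).
by apply: (IH s' (rng (swap x y).1) (rng (swap x' y').1)) => //=;
  rewrite ?c1 ?c1' // ?p2 ?p2' ?p4 ?p4' eqxx.
Qed.

Lemma color_normal v v' s s' : is_path v s -> is_path v' s' ->
  map color s = map color s' -> map color (normal s) = map color (normal s').
Proof.
elim: s s' v v' => [|x s IH] [|x' s'] v v' //=.
move=> /andP[/eqP xv xs] /andP[/eqP xv' xs'] [cx cs].
have [p _] := normal_path xs; have [p' _] := normal_path xs'.
by apply: (@color_insert v v') => //=; rewrite ?xv ?xv' ?eqxx //;
  apply: IH xs xs' cs.
Qed.

Lemma normal_inj v v' s s' : is_path v s -> is_path v' s' ->
  map color s = map color s' -> normal s = normal s' -> s = s'.
Proof.
elim: s s' v v' => [|x s IH] [|x' s'] v v' //=.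
move=> /andP[/eqP xv xs] /andP[/eqP xv' xs'] [cx cs].
have [p _] := normal_path xs; have [p' _] := normal_path xs'.
move=> e; have px : is_path v (x :: normal s) by rewrite /= xv eqxx.
have px' : is_path v' (x' :: normal s') by rewrite /= xv' eqxx.
have [-> en] := insert_inj cx (color_normal xs xs' cs) px px' e.
by rewrite (IH _ _ _ xs xs' cs en).
Qed.

(** A total constructor: it falls back to the trivial path at [v] when [s] is not a path from
    [v]. *)
Definition mkpath v s : dpath D := insubd (path_id v) (v, s).

Lemma val_mkpath v s : is_path v s -> val (mkpath v s) = (v, s).
Proof. by move=> vs; rewrite val_insubd /= vs. Qed.

Lemma mkpathE (a : dpath D) : mkpath (val a).1 (val a).2 = a.
Proof. by apply: val_inj; rewrite val_mkpath ?(valP a) //; case: (val a). Qed.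

Lemma mkpath_cat v s t : is_path v s -> is_path (path_end v s) t ->
  path_comp (mkpath v s) (mkpath (path_end v s) t) = mkpath v (s ++ t).
Proof.
move=> vs st; apply: val_inj.
by rewrite val_path_comp /path_dom /path_cod !val_mkpath ?is_path_cat ?vs.
Qed.

Lemma path2E x y : rng x = src y ->
  path_comp (edge_path x) (edge_path y) = mkpath (src x) [:: x; y].
Proof.
move=> xy; have E z : edge_path z = mkpath (src z) [:: z] by [].
by rewrite !E -xy (@mkpath_cat _ [:: x] [:: y]) //= ?eqxx ?xy ?eqxx.
Qed.

(* Quantifying over the continuation [s] makes the relation compatible with
   composition on the right. *)
Definition sorted_congr (a b : mor (path_category D)) : Prop :=
  parallel a b /\ forall s, is_path (dom a) s ->
    normal ((val a).2 ++ s) = normal ((val b).2 ++ s).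

Lemma sorted_congr_parallel a b : sorted_congr a b -> parallel a b.
Proof. by case. Qed.

Lemma sorted_congr_refl a : sorted_congr a a.
Proof. by []. Qed.

Lemma sorted_congr_sym a b : sorted_congr a b -> sorted_congr b a.
Proof. by case=> -[h1 h2] H; split=> [//|s]; rewrite -h2 => /H. Qed.

Lemma sorted_congr_trans a b c :
  sorted_congr a b -> sorted_congr b c -> sorted_congr a c.
Proof.
move=> [[h1 h2] H] [[h1' h2'] H']; split; first by rewrite /parallel h1 h2.
by move=> s sa; rewrite H // H' // -h2.
Qed.

Lemma sorted_congr_comp a a' b b' : sorted_congr a a' -> sorted_congr b b' ->
  dom a = cod b -> sorted_congr (comp a b) (comp a' b').
Proof.
move=> [[h1 h2] H] [[k1 k2] K] ab.
have ab' : dom a' = cod b' by rewrite -h2 -k1.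
split; first by rewrite /parallel !cod_comp // !dom_comp.
move=> s; rewrite dom_comp // !val_path_comp //= -!catA => bs.
rewrite H; last by rewrite is_path_cat ab (valP b).
(* Sorting is a right fold, so the normal form of the second factor with its continuation can be
   replaced under the insertions of the first. *)
by rewrite /normal foldr_cat -/(normal _) K // -foldr_cat.
Qed.

Definition sorted_congruence : congruence (path_category D) :=
  Congruence sorted_congr_parallel sorted_congr_refl sorted_congr_sym
    sorted_congr_trans sorted_congr_comp.

(** * The congruence generated by squares *)

Variable S : congruence (path_category D).
Hypothesis sq_S : forall x y y' x', sq x y y' x' ->
  S (comp (edge_path x) (edge_path y)) (comp (edge_path y') (edge_path x')).
Hypothesis S_smallest : forall S' : congruence (path_category D),
  (forall x y y' x', sq x y y' x' ->
    S' (comp (edge_path x) (edge_path y))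
       (comp (edge_path y') (edge_path x'))) ->
  forall a b, S a b -> S' a b.

(** By minimality of [S] it is enough that squares lie in [sorted_congruence], which is [insert_sq];
    then the empty continuation is taken. *)
Lemma S_normal a b : S a b -> normal (val a).2 = normal (val b).2.
Proof.
move=> ab; have [] := @S_smallest sorted_congruence _ a b ab; last first.
  by move=> _ /(_ [::] isT); rewrite !cats0.
move=> x y y' x' h; have [p1 p2 p3 p4] := sq_path sqP h.
rewrite /= !path2E //; split.
  rewrite /parallel /= /path_cod /path_dom.
  by rewrite !val_mkpath //= ?p1 ?p2 ?eqxx //= ?p3 ?p4.
move=> s; rewrite /= /path_dom !val_mkpath //= ?p1 ?p2 ?eqxx //= => ys.
by have [ns _] := normal_path ys; apply: insert_sq.
Qed.

(** The uniqueness half of factorization; [S_reorder] is the existence half. *)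
Lemma S_colors_eq a b : S a b ->
  map color (val a).2 = map color (val b).2 -> a = b.
Proof.
move=> ab cab; have [e _] := cong_parallel ab.
rewrite -(mkpathE a) -(mkpathE b); congr mkpath; first exact: e.
exact: normal_inj (valP a) (valP b) cab (S_normal ab).
Qed.

Lemma S_cons v x s t : src x = v -> is_path (rng x) s -> is_path (rng x) t ->
  S (mkpath (rng x) s) (mkpath (rng x) t) ->
  S (mkpath v (x :: s)) (mkpath v (x :: t)).
Proof.
move=> xv ps pt st; rewrite -(cat1s x s) -(cat1s x t).
have p1 : is_path v [:: x] by rewrite /= xv eqxx.
have E u : is_path (rng x) u -> mkpath v ([:: x] ++ u) =
    comp (mkpath v [:: x] : mor (path_category D)) (mkpath (rng x) u).
  by move=> pu; rewrite [RHS](@mkpath_cat v [:: x] u).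
rewrite (E s ps) (E t pt); apply: cong_comp => //; first exact: cong_refl.
by rewrite /= /path_dom /path_cod !val_mkpath.
Qed.

Lemma is_path_sq v x y y' x' s : is_path v [:: x, y & s] ->
  sq x y y' x' -> is_path v [:: y', x' & s].
Proof.
move=> /= /and3P[xv xy ys] /(sq_path sqP)[q1 q2 q3 q4].
by rewrite q3 q2 q4 eqxx xv.
Qed.

Lemma S_sq v x y y' x' s : is_path v [:: x, y & s] -> sq x y y' x' ->
  S (mkpath v [:: x, y & s]) (mkpath v [:: y', x' & s]).
Proof.
move=> p h; have p' := is_path_sq p h; have [q1 q2 q3 q4] := sq_path sqP h.
have /= /and3P[/eqP xv xy ps] := p; have /= /and3P[_ yx' ps'] := p'.
have pxy : is_path v [:: x; y] by rewrite /= xv xy eqxx.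
have pyx : is_path v [:: y'; x'] by rewrite /= q3 xv yx' eqxx.
rewrite -(@mkpath_cat v [:: x; y] s) // -(@mkpath_cat v [:: y'; x'] s) //= q4.
apply: cong_comp; last 2 first.
- exact: cong_refl.
- by rewrite /= /path_dom /path_cod !val_mkpath.
by have := sq_S h; rewrite /= !path2E // q3 xv.
Qed.

Lemma S_bring v s c : is_path v s -> c \in map color s ->
  exists x t, [/\ is_path v (x :: t), S (mkpath v s) (mkpath v (x :: t)),
    perm_eq (map color (x :: t)) (map color s) & color x = c].
Proof.
elim: s v => [|y s IH] v // /andP[/eqP yv ys]; rewrite /= inE.
have [-> _|ncy /= cs] := eqVneq c (color y).
  by exists y, s; split; rewrite /= ?yv ?eqxx //; apply: cong_refl.
have [x [t [/andP[/eqP xy pt] st cxt cx]]] := IH _ ys cs.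
have [|y' [x' h]] := sq_exists sqP (esym xy); first by rewrite cx eq_sym.
have [c1 c2 _] := sq_color sqP h.
have pyx : is_path v [:: y, x & t] by rewrite /= yv xy !eqxx.
exists y', (x' :: t); split.
- exact: is_path_sq pyx h.
- apply: (@cong_trans _ S _ (mkpath v (y :: x :: t))); last exact: S_sq.
  by apply: S_cons => //; rewrite /= xy eqxx.
- rewrite /= c1 c2 -(perm_cons (color y)) in cxt *; apply: perm_trans cxt.
  exact/permPl/(perm_catCA [:: _] [:: _]).
- by rewrite c2.
Qed.

(** Selection sort towards [w]: its first letter is brought to the front, and the tail is treated
    recursively. *)
Lemma S_reorder w v s : is_path v s -> perm_eq w (map color s) ->
  exists t, [/\ is_path v t, S (mkpath v s) (mkpath v t) & map color t = w].
Proof.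
elim: w v s => [|c w IH] v s ps.
  move=> /perm_size /=; case: s ps => // _ _.
  by exists [::]; split=> //; apply: cong_refl.
move=> pw; have [|x [t [pt st ct cx]]] := @S_bring v s c ps.
  by rewrite -(perm_mem pw) mem_head.
have [/eqP xv pt'] := andP pt.
have [|u [pu tu cu]] := IH (rng x) t pt'.
  by rewrite -(perm_cons c); apply: perm_trans pw _; rewrite perm_sym -cx.
exists (x :: u); split; rewrite /= ?xv ?eqxx ?cx ?cu //.
by apply: cong_trans st _; apply: S_cons.
Qed.

(** * Unique factorization in the quotient *)

Definition word_deg (a : dpath D) : degree k :=
  \sum_(x <- (val a).2) unit_deg (color x).

Lemma word_degE a i : word_deg a i = count_mem i (map color (val a).2).
Proof.
rewrite /word_deg; elim: (val a).2 => [|x s IH]; first by rewrite big_nil ffunE.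
by rewrite big_cons /= !ffunE IH eq_sym.
Qed.

Lemma word_deg_perm a b : word_deg a = word_deg b ->
  perm_eq (map color (val a).2) (map color (val b).2).
Proof. by move=> e; apply/allP => i _; rewrite /= -!word_degE e. Qed.

(** A chosen color word of degree [n], which fixes the representatives to be cut into factors. *)
Definition word (n : degree k) : seq 'I_k :=
  flatten [seq nseq (n i) i | i <- enum 'I_k].

Lemma count_word n i : count_mem i (word n) = n i.
Proof.
rewrite count_flatten -map_comp sumnE big_map big_enum /= (bigD1 i) //=.
rewrite count_nseq /= eqxx mul1n big1 ?addn0 // => j ji.
by rewrite count_nseq /= (negPf ji).
Qed.

Hypothesis S_deg : forall a b, S a b -> word_deg a = word_deg b.

Lemma quot_reorder (l : mor (quotient_category S)) w :
  perm_eq w (map color (val (repr l)).2) ->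
  exists a : mor (path_category D),
    quot_class S a = l /\ map color (val a).2 = w.
Proof.
move=> pw; have [t [pt st ct]] := S_reorder (valP (repr l)) pw.
exists (mkpath (val (repr l)).1 t); rewrite val_mkpath //; split=> //.
rewrite -[RHS]quot_class_repr; apply/quot_classP.
by apply: cong_sym; rewrite mkpathE in st.
Qed.

Lemma quot_colors_eq (a b : mor (path_category D)) :
  quot_class S a = quot_class S b ->
  map color (val a).2 = map color (val b).2 -> a = b.
Proof. by move=> /quot_classP; apply: S_colors_eq. Qed.

Lemma quot_unique_factorization :
  @unique_factorization k (quotient_category S) (fun l => word_deg (repr l)).
Proof.
have dc a : word_deg (repr (quot_class S a)) = word_deg a.
  by apply: S_deg; apply: repr_quot_class.
move=> l n m lnm.
have [|b [bl cb]] := @quot_reorder l (word n ++ word m).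
  by apply/allP => i _; rewrite /= -word_degE lnm count_cat !count_word ffunE.
(* The representative with colors [word n ++ word m] is cut after its first [size (word n)]
   edges. *)
have [v [s1 [s2 [p1 p2 c1 c2 bE]]]] : exists v s1 s2, [/\ is_path v s1,
    is_path (path_end v s1) s2, map color s1 = word n, map color s2 = word m &
    b = mkpath v (s1 ++ s2)].
  have := valP b; rewrite -{1}(cat_take_drop (size (word n)) (val b).2).
  rewrite is_path_cat => /andP[h1 h2].
  exists (val b).1, (take (size (word n)) (val b).2),
    (drop (size (word n)) (val b).2).
  split=> //; rewrite ?cat_take_drop ?mkpathE //.
    by rewrite map_take cb take_size_cat.
  by rewrite map_drop cb drop_size_cat.
pose b1 := mkpath v s1 : mor (path_category D).
pose b2 := mkpath (path_end v s1) s2 : mor (path_category D).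
have d12 : dom b1 = cod b2 by rewrite /= /path_dom /path_cod !val_mkpath.
have e12 : comp b1 b2 = b by rewrite bE -mkpath_cat.
have e1 : word_deg b1 = n.
  by apply/ffunP => i; rewrite word_degE val_mkpath // c1 count_word.
have e2 : word_deg b2 = m.
  by apply/ffunP => i; rewrite word_degE val_mkpath // c2 count_word.
exists (quot_class S b1, quot_class S b2); split.
  split.
  - exact: etrans (quot_dom_class _ _) (etrans d12 (esym (quot_cod_class _ _))).
  - by rewrite -bl -e12; apply: quot_comp_class.
  - exact: etrans (dc _) e1.
  - exact: etrans (dc _) e2.
move=> [l1 l2] /= [xy xyl dx dy].
(* The factors of a competing factorization get representatives with the colors of [s1] and [s2].
   The two composites then share a class and a color word, so they are the same path and split at
   the same place. *)
have [|a1 [a1x ca1]] := @quot_reorder l1 (map color s1).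
  by have := @word_deg_perm b1 (repr l1); rewrite val_mkpath // dx e1; apply.
have [|a2 [a2y ca2]] := @quot_reorder l2 (map color s2).
  by have := @word_deg_perm b2 (repr l2); rewrite val_mkpath // dy e2; apply.
have da : dom a1 = cod a2.
  by rewrite -(quot_dom_class S) -(quot_cod_class S) a1x a2y; apply: xy.
have E : comp a1 a2 = comp b1 b2.
  apply: quot_colors_eq.
    by rewrite e12 bl -xyl -a1x -a2y [RHS]quot_comp_class.
  by rewrite !val_path_comp // !val_mkpath // !map_cat ca1 ca2.
have := congr1 val E; rewrite !val_path_comp // !val_mkpath // => -[v1 /eqP].
have sz : size (val a1).2 = size s1 by rewrite -(size_map color) ca1 size_map.
rewrite eqseq_cat // => /andP[/eqP q1 /eqP q2].
have E1 : a1 = b1 by rewrite -(mkpathE a1) v1 q1.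
rewrite -a1x -a2y E1; congr (_, quot_class S _).
rewrite -(mkpathE a2) q2; congr mkpath.
by have := da; rewrite E1 d12 /= /path_cod val_mkpath.
Qed.

End ColoredGraph.

(** * Textile systems *)

Section TextileSquares.

(** Elements are maps from the one-point set, here [unit], so the universal property yields elements
    of the fibre product; [pullback_inj] uses its uniqueness in the same way. *)
Lemma pullback_exists (A B C D : Type) (f : A -> B) (g : A -> C)
    (h : B -> D) (k : C -> D) b c :
  is_pullback f g h k -> h b = k c -> exists a, f a = b /\ g a = c.
Proof.
move=> [_ /(_ unit (fun=> b) (fun=> c)) P] bc.
by have [|w [[wb wc] _]] := P; last by exists (w tt); rewrite -(wb tt) -(wc tt).
Qed.

Lemma pullback_inj (A B C D : Type) (f : A -> B) (g : A -> C)
    (h : B -> D) (k : C -> D) a a' :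
  is_pullback f g h k -> f a = f a' -> g a = g a' -> a = a'.
Proof.
move=> [hk /(_ unit (fun=> f a') (fun=> g a')) P] fa ga.
have [|w [_ U]] := P; first by move=> u; apply: hk.
have E (c : A) : f c = f a' -> g c = g a' -> w = fun=> c.
  by move=> fc gc; apply: U; split=> u /=.
by have := E _ fa ga; rewrite (E a' erefl erefl) => /(congr1 (@^~ tt)).
Qed.

Lemma r_lift_inj (F E : digraph) (f : ghom F E) x y :
  unique_r_path_lifting f -> rng x = rng y -> hom1 f x = hom1 f y -> x = y.
Proof.
move=> L xy fxy; have [|z [_ U]] := L (rng y) (hom1 f y).
  by rewrite hom_rng.
by rewrite -(U y) // (U x).
Qed.

Lemma s_lift_inj (F E : digraph) (f : ghom F E) x y :
  unique_s_path_lifting f -> src x = src y -> hom1 f x = hom1 f y -> x = y.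
Proof.
move=> L xy fxy; have [|z [_ U]] := L (src y) (hom1 f y).
  by rewrite hom_src.
by rewrite -(U y) // (U x).
Qed.

Variable T : textile.

(** Each relation is matched in both orientations, which makes [sq_sym] immediate. *)
Definition textile_sq (x y y' x' : edge (GT T)) : Prop :=
  match x, y, y', x' with
  | inl (inr a), inl (inl b), inl (inl c), inl (inr d)
  | inl (inl c), inl (inr d), inl (inr a), inl (inl b) =>
      exists z, [/\ a = hom0 (p2 T) z, b = hom0 (q1 T) z,
                    c = hom0 (p1 T) z & d = hom0 (q2 T) z]
  | inl (inl a), inr b, inr c, inl (inl d)
  | inr c, inl (inl d), inl (inl a), inr b =>
      exists z, [/\ a = src z, b = hom1 (h1 T) z, c = hom1 (g1 T) z & d = rng z]
  | inl (inr a), inr b, inr c, inl (inr d)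
  | inr c, inl (inr d), inl (inr a), inr b =>
      exists z, [/\ a = src z, b = hom1 (h2 T) z, c = hom1 (g2 T) z & d = rng z]
  | _, _, _, _ => False
  end.

Lemma colorE (x : edge (GT T)) : color x =
  match x with inl (inl _) => 1 | inl (inr _) => 0 | inr _ => 2 end :> nat.
Proof. by case: x => [[x|x]|x] /=; rewrite inordK. Qed.

Hypothesis q1_lift : s_path_lifting (q1 T).
Hypothesis g1_lift : unique_r_path_lifting (g1 T).
Hypothesis g2_lift : unique_r_path_lifting (g2 T).
Hypothesis h1_lift : unique_s_path_lifting (h1 T).
Hypothesis h2_lift : unique_s_path_lifting (h2 T).
Hypothesis pullback_qp : is_pullback (hom0 (q1 T)) (hom0 (p2 T))
                                     (hom0 (g1 T)) (hom0 (h2 T)).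
Hypothesis pullback_pq : is_pullback (hom0 (p1 T)) (hom0 (q2 T))
                                     (hom0 (h1 T)) (hom0 (g2 T)).

(** Edges from $F_1^0$ and $F_2^0$ meet in one of the two pullbacks. An edge of $F_i^0$ followed by
    one of $E^1$ needs $s$-path lifting of $h_i$, and the opposite order needs $r$-path lifting of
    $g_i$. Uniqueness of squares splits into the same six cases. *)
Lemma textile_sq_exists (x y : edge (GT T)) : rng x = src y ->
  color x != color y -> exists y' x', textile_sq x y y' x'.
Proof.
case: x y => [[x|x]|x] [[y|y]|y] //= xy; rewrite ?eqxx // => _.
- have [z [<- <-]] := pullback_exists pullback_pq xy.
  by exists (ofF2 (hom0 (p2 T) z)), (ofF1 (hom0 (q1 T) z)), z.
- have [z [[<- <-] _]] := h1_lift xy.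
  by exists (ofE (hom1 (g1 T) z)), (ofF1 (rng z)), z.
- have [z [<- <-]] := pullback_exists pullback_qp (esym xy).
  by exists (ofF1 (hom0 (p1 T) z)), (ofF2 (hom0 (q2 T) z)), z.
- have [z [[<- <-] _]] := h2_lift xy.
  by exists (ofE (hom1 (g2 T) z)), (ofF2 (rng z)), z.
- have [z [[<- <-] _]] := g1_lift (esym xy).
  by exists (ofF1 (src z)), (ofE (hom1 (h1 T) z)), z.
- have [z [[<- <-] _]] := g2_lift (esym xy).
  by exists (ofF2 (src z)), (ofE (hom1 (h2 T) z)), z.
Qed.

Lemma textile_sq_uniq (x y y1 x1 y2 x2 : edge (GT T)) :
  textile_sq x y y1 x1 -> textile_sq x y y2 x2 -> y1 = y2 /\ x1 = x2.
Proof.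
case: x y => [[x|x]|x] [[y|y]|y] //=;
case: y1 x1 => [[y1|y1]|y1] [[x1|x1]|x1] //=;
case: y2 x2 => [[y2|y2]|y2] [[x2|x2]|x2] //= [z [-> -> -> ->]] [z'].
- by case=> -> -> e1 e2; rewrite (pullback_inj pullback_pq e1 e2).
- by case=> e1 e2 -> ->; rewrite (s_lift_inj h1_lift e1 e2).
- by case=> e1 e2 -> ->; rewrite (pullback_inj pullback_qp e2 e1).
- by case=> e1 e2 -> ->; rewrite (s_lift_inj h2_lift e1 e2).
- by case=> -> -> e1 e2; rewrite (r_lift_inj g1_lift e2 e1).
- by case=> -> -> e1 e2; rewrite (r_lift_inj g2_lift e2 e1).
Qed.

Lemma textile_complete : complete_squares (@color T) textile_sq.
Proof.
have [gp gp'] := textile_gp T; have [hq hq'] := textile_hq T.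
have [gq gq'] := textile_gq T; have [hp hp'] := textile_hp T.
split.
- by move=> [[x|x]|x] [[y|y]|y] [[y'|y']|y'] [[x'|x']|x'].
- move=> [[x|x]|x] [[y|y]|y] [[y'|y']|y'] [[x'|x']|x'] //= _;
  by split=> //; apply/eqP => /(congr1 val) /=; rewrite !inordK.
- move=> [[x|x]|x] [[y|y]|y] [[y'|y']|y'] [[x'|x']|x'] //= [z [-> -> -> ->]];
  by rewrite ?hom_src ?hom_rng ?gp ?hq ?gq ?hp.
- exact: textile_sq_exists.
- exact: textile_sq_uniq.
move=> x y z y' x' z1 y1 z2 x1 z3 x3 z4 y4; rewrite !colorE.
(* Increasing colors leave only $x \in F_2^0$, $y \in F_1^0$, $z \in E^1$. Below, [t] is the vertex
   of $G$ filling the first square and [u] the edge of $F_1$ filling the second. *)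
case: x y => [[x|x]|x] [[y|y]|y] //= _; case: z => [[z|z]|z] //= _.
case: y' x' => [[y'|y']|y'] [[x'|x']|x'] //= [t [-> -> -> ->]].
case: z1 y1 => [[z1|z1]|z1] [[y1|y1]|y1] //= [u [tu -> -> ->]].
(* Path lifting of $q_1$ gives $w \in G^1$, whose six faces are the squares
   met on the two ways round the cube. *)
have [w [wt wu]] : exists w, src w = t /\ hom1 (q1 T) w = u by apply: q1_lift.
move=> {tu}; rewrite -{}wu -{t}wt => hxz hx'z hy'z.
(* Uniqueness of squares identifies the three remaining swaps, in turn, with the faces $p_2(w)$,
   $q_2(w)$ and $p_1(w)$. *)
have [|-> ->] := @textile_sq_uniq
  (ofF2 (hom0 (p2 T) (src w))) (ofE (hom1 (g1 T) (hom1 (q1 T) w))) _ _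
  (ofE (hom1 (g2 T) (hom1 (p2 T) w))) (ofF2 (rng (hom1 (p2 T) w))) hxz.
  by exists (hom1 (p2 T) w); rewrite hom_src gq'.
have [|z3E ->] := @textile_sq_uniq
  (ofF2 (hom0 (q2 T) (src w))) (ofE (hom1 (h1 T) (hom1 (q1 T) w))) _ _
  (ofE (hom1 (g2 T) (hom1 (q2 T) w))) (ofF2 (rng (hom1 (q2 T) w))) hx'z.
  by exists (hom1 (q2 T) w); rewrite hom_src hq'.
rewrite z3E in hy'z; have [|-> ->] := @textile_sq_uniq
  (ofF1 (hom0 (p1 T) (src w))) (ofE (hom1 (g2 T) (hom1 (q2 T) w))) _ _
  (ofE (hom1 (g1 T) (hom1 (p1 T) w))) (ofF1 (rng (hom1 (p1 T) w))) hy'z.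
  by exists (hom1 (p1 T) w); rewrite hom_src hp'.
(* The two routes end in $g_2p_2(w)$ and $g_1p_1(w)$, which agree, and the closing square is the
   range of [w]. *)
by rewrite gp'; split=> //; exists (rng w); rewrite !hom_rng.
Qed.

End TextileSquares.

(** * Faces of a composite *)

Section Faces.
Variables (k : nat) (L : kgraph k).
Implicit Types a b l : mor L.

(** Composing with an identity on the right exhibits [b] as the segment, which is unique by
    [segmentP]; [face_false] puts the identity on the left. *)
Lemma face_true i a b : dom a = cod b -> deg a = unit_deg i ->
  face true i (comp a b) = b.
Proof.
move=> ab da; have dl := deg_comp ab; apply/esym.
rewrite /face; have [|j|_] :=
  @segmentP _ L (comp a b) (unit_deg i) (deg (comp a b)).
- by move=> j; rewrite dl da !ffunE; apply: leq_addr.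
- by [].
apply; exists a, (idm (dom b)); split=> //.
- by rewrite cod_idm.
- by rewrite -(dom_comp ab) comp_idr.
have [[-> _] _] := kgraphP L.
by apply/ffunP => j; rewrite !ffunE subnn.
Qed.

Lemma face_false i a b : dom a = cod b -> deg b = unit_deg i ->
  face false i (comp a b) = a.
Proof.
move=> ab db; have dl := deg_comp ab; apply/esym.
rewrite /face; have [|j|_] :=
  @segmentP _ L (comp a b) 0 (deg_sub (deg (comp a b)) (unit_deg i)).
- by move=> j; rewrite ffunE.
- by rewrite ffunE leq_subr.
apply; exists (idm (cod a)), b; split=> //.
- by rewrite dom_idm.
- by rewrite comp_idl.
- by have [[-> _] _] := kgraphP L.
apply/ffunP => j; rewrite dl db !ffunE; lia.
Qed.

End Faces.

(** * Alternating sums over the edges of a path *)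

Section SignedSums.
Variables (X : Type) (c : X -> nat) (V : lmodType int) (F : bool -> X -> V).

(** The cube boundary written along a path: [c] is the color, [F] gives the faces, and the count is
    the rank of a color among those of the path. *)
Definition signed_sum (s : seq X) : V := \sum_(b : bool) \sum_(x <- s)
  (-1) ^+ ((count (fun y => c y < c x)%N s).+1 + b) *: F b x.

Lemma scale_sign i (v : V) : (-1) ^+ i *: v = if odd i then - v else v.
Proof. by rewrite -signr_odd scaler_sign. Qed.

Lemma signed_sum1 x : signed_sum [:: x] = F true x - F false x.
Proof.
by rewrite /signed_sum big_bool !big_cons !big_nil !scale_sign /= !ltnn !addr0.
Qed.

(* The summands come in the order of [textile_bnd2] and [textile_bnd3]. *)
Lemma signed_sum2 x y : (c x < c y)%N ->
  signed_sum [:: x; y] = F false y + F true x - F false x - F true y.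
Proof.
move=> xy; rewrite /signed_sum big_bool !big_cons !big_nil !scale_sign /= !ltnn.
by rewrite xy ltnNge ltnW //= !addr0 !addrA [LHS](ACl (4*1*3*2)).
Qed.

Lemma signed_sum3 x y z : (c x < c y)%N -> (c y < c z)%N ->
  signed_sum [:: x; y; z] =
    F true z + F false y + F true x - F false z - F false x - F true y.
Proof.
move=> xy yz; have xz := ltn_trans xy yz.
have gtF u v : (u < v)%N -> (v < u)%N = false.
  by move=> /ltnW; rewrite leqNgt => /negbTE.
rewrite /signed_sum big_bool !big_cons !big_nil !scale_sign /= !ltnn.
rewrite xy yz xz (gtF _ _ xy) (gtF _ _ yz) (gtF _ _ xz) /= !addr0 !addrA.
(* Positions refer to the expanded sum, where the three [true] terms precede the three [false]
   ones. *)
by rewrite [LHS](ACl (3*5*1*6*4*2)).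
Qed.

End SignedSums.

(** * Path classes and squares of a textile system *)

Section TextileCubes.
Variable T : textile.

Local Notation S := (textile_congruence T).
Local Notation pcat := (path_category (GT T)).

Definition path_class (v : vertex (gE T)) (s : seq (edge (GT T))) :
    mor (Lambda T) :=
  quot_class S (mkpath (v : vertex (GT T)) s : mor pcat).

Lemma path_class_deg v s : @is_path (GT T) v s ->
  Lambda_deg (path_class v s) = \sum_(x <- s) unit_deg (color x).
Proof. by move=> p; rewrite Lambda_deg_class /path_deg val_mkpath. Qed.

Lemma path_class_cod v s : @is_path (GT T) v s -> cod (path_class v s) = v.
Proof. by move=> p; rewrite [LHS]quot_cod_class /= /path_cod val_mkpath. Qed.

Lemma path_class_dom v s : @is_path (GT T) v s ->
  dom (path_class v s) = @path_end (GT T) v s.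
Proof. by move=> p; rewrite [LHS]quot_dom_class /= /path_dom val_mkpath. Qed.

Lemma path_class_cat v s t : @is_path (GT T) v (s ++ t) ->
  path_class v (s ++ t) =
    comp (path_class v s) (path_class (@path_end (GT T) v s) t).
Proof.
rewrite is_path_cat => /andP[p q].
rewrite [RHS]quot_comp_class;
  last by rewrite /= /path_dom /path_cod !val_mkpath.
by rewrite /path_class /= mkpath_cat.
Qed.

(** The generating relations are oriented while [textile_sq] is symmetric, hence the disjunction. *)
Lemma textile_sq_rel (x y y' x' : edge (GT T)) : textile_sq x y y' x' ->
  textile_rel (path2 x y) (path2 y' x') \/
  textile_rel (path2 y' x') (path2 x y).
Proof.
case: x y y' x' => [[x|x]|x] [[y|y]|y] [[y'|y']|y'] [[x'|x']|x'] h;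
simpl in h; try (solve [destruct h]); case: h => z [-> -> -> ->].
- right; exact: (rel_G z).
- left; exact: (rel_F1 z).
- left; exact: (rel_G z).
- left; exact: (rel_F2 z).
- right; exact: (rel_F1 z).
- right; exact: (rel_F2 z).
Qed.

Lemma textile_rel_sq a b : textile_rel a b ->
  exists x y y' x' : edge (GT T),
    [/\ a = path2 x y, b = path2 y' x' & textile_sq x y y' x'].
Proof.
case=> z; first 1 last.
- exists (ofF1 (src z)), (ofE (hom1 (h1 T) z)), (ofE (hom1 (g1 T) z)).
  by exists (ofF1 (rng z)); split=> //; exists z.
- exists (ofF2 (src z)), (ofE (hom1 (h2 T) z)), (ofE (hom1 (g2 T) z)).
  by exists (ofF2 (rng z)); split=> //; exists z.
exists (ofF2 (hom0 (p2 T) z)), (ofF1 (hom0 (q1 T) z)), (ofF1 (hom0 (p1 T) z)).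
by exists (ofF2 (hom0 (q2 T) z)); split=> //; exists z.
Qed.

Lemma textile_sq_congruence (x y y' x' : edge (GT T)) : textile_sq x y y' x' ->
  S (path2 x y) (path2 y' x').
Proof.
move=> /textile_sq_rel[] h; first exact: gen_rel.
by apply: gen_sym; apply: gen_rel.
Qed.

Lemma textile_congruence_smallest (S' : congruence pcat) :
  (forall x y y' x' : edge (GT T),
    textile_sq x y y' x' -> S' (path2 x y) (path2 y' x')) ->
  forall a b, S a b -> S' a b.
Proof.
move=> H; apply: generated_smallest => a b.
move=> /textile_rel_sq[x [y [y' [x' [-> -> h]]]]].
exact: H.
Qed.

End TextileCubes.

(** * The 3-graph and its cubes *)

Section TextileKGraph.
Variable T : textile.
Hypothesis q1_lift : s_path_lifting (q1 T).
Hypothesis g1_lift : unique_r_path_lifting (g1 T).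
Hypothesis g2_lift : unique_r_path_lifting (g2 T).
Hypothesis h1_lift : unique_s_path_lifting (h1 T).
Hypothesis h2_lift : unique_s_path_lifting (h2 T).
Hypothesis pullback_qp : is_pullback (hom0 (q1 T)) (hom0 (p2 T))
                                     (hom0 (g1 T)) (hom0 (h2 T)).
Hypothesis pullback_pq : is_pullback (hom0 (p1 T)) (hom0 (q2 T))
                                     (hom0 (h1 T)) (hom0 (g2 T)).

Local Notation S := (textile_congruence T).

Let sqP := textile_complete q1_lift g1_lift g2_lift h1_lift h2_lift
  pullback_qp pullback_pq.

Lemma Lambda_kgraph : is_kgraph (@Lambda_deg T).
Proof.
split; first exact: Lambda_degree_functor.
apply: (quot_unique_factorization sqP).
- exact: textile_sq_congruence.
- exact: textile_congruence_smallest.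
- exact: path_deg_congruence.
Qed.

Definition textile_3graph := KGraph Lambda_kgraph.
Local Notation L := textile_3graph.

(* The representative with increasing colors of the cube attached to a basis
   element. *)
Definition cube_path (n : nat) : textile_basis T n ->
  vertex (GT T) * seq (edge (GT T)) :=
  match n with
  | 0 => fun v => (v, [::])
  | 1 => fun x => (src (x : edge (GT T)), [:: x])
  | 2 => fun x => match x with
         | inl (inl x) => (hom0 (g2 T) (hom0 (p2 T) x),
                           [:: ofF2 (hom0 (p2 T) x); ofF1 (hom0 (q1 T) x)])
         | inl (inr x) => (hom0 (g1 T) (src x),
                           [:: ofF1 (src x); ofE (hom1 (h1 T) x)])
         | inr x => (hom0 (g2 T) (src x),
                     [:: ofF2 (src x); ofE (hom1 (h2 T) x)])
         end
  | 3 => fun z => (hom0 (g2 T) (hom0 (p2 T) (src z)),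
                   [:: ofF2 (hom0 (p2 T) (src z)); ofF1 (hom0 (q1 T) (src z));
                       ofE (hom1 (h1 T) (hom1 (q1 T) z))])
  | _ => fun x => match x with end
  end.

Lemma cube_pathP n (x : textile_basis T n) :
  [/\ is_path (cube_path x).1 (cube_path x).2,
      sorted ltn (map (fun e => color e : nat) (cube_path x).2) &
      size (cube_path x).2 = n].
Proof.
have [gq _] := textile_gq T.
case: n x => [|[|[|[|n]]]] //=; first by move=> x; rewrite eqxx.
- by move=> [[x|x]|x] /=; rewrite ?eqxx ?hom_src ?gq ?inordK ?eqxx.
- by move=> x; rewrite !inordK // !hom_src gq !eqxx.
Qed.

(** In degree 3 the path determines the source through a pullback, then the edge under $q_1$ by
    lifting along $h_1$. The commutation relations and unique lifting carry this to $p_2$, $q_2$ and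
    $p_1$, a pullback gives the range, and condition $\mathcal I$ concludes. *)
Lemma cube_path_inj n : injective (@cube_path n).
Proof.
have [gp gp'] := textile_gp T; have [hq hq'] := textile_hq T.
have [gq gq'] := textile_gq T; have [hp hp'] := textile_hp T.
case: n => [|[|[|[|n]]]] //=.
- by move=> x y [].
- by move=> x y [].
- move=> [[x|x]|x] [[y|y]|y] //= [] => [_ e1 e2|_ e1 e2|_ e1 e2].
  + by rewrite (pullback_inj pullback_qp e2 e1).
  + by rewrite (s_lift_inj h1_lift e1 e2).
  + by rewrite (s_lift_inj h2_lift e1 e2).
move=> x y [_ e1 e2 e3].
have ez : src x = src y := pullback_inj pullback_qp e2 e1.
have eq1 : hom1 (q1 T) x = hom1 (q1 T) y.
  by apply: (s_lift_inj h1_lift) => //; rewrite !hom_src ez.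
have ep2 : hom1 (p2 T) x = hom1 (p2 T) y.
  by apply: (s_lift_inj h2_lift); rewrite -?gq' ?eq1 // !hom_src ez.
have eq2 : hom1 (q2 T) x = hom1 (q2 T) y.
  by apply: (s_lift_inj h2_lift); rewrite -?hq' ?eq1 // !hom_src ez.
have ep1 : hom1 (p1 T) x = hom1 (p1 T) y.
  by apply: (s_lift_inj h1_lift); rewrite ?hp' ?eq2 // !hom_src ez.
have er : rng x = rng y.
  by apply: (pullback_inj pullback_qp); rewrite -!hom_rng ?eq1 ?ep2.
by apply: textile_injG1; rewrite /= ez er ep1 eq1 ep2 eq2.
Qed.

Lemma cube_path_surj n v s : is_path v s ->
  sorted ltn (map (fun e => color e : nat) s) -> size s = n ->
  exists x : textile_basis T n, cube_path x = (v, s).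
Proof.
case: n s => [|[|[|[|n]]]] [|x [|y [|z [|t s]]]] //=.
- by exists v.
- by rewrite andbT => /eqP<-; exists x.
- move=> /and3P[/eqP<- /eqP yx _]; rewrite !colorE.
  case: x y yx => [[x|x]|x] [[y|y]|y] //= yx _ _.
  + by have [z [[<- <-] _]] := h1_lift (esym yx); exists (ofF1e z).
  + have [z [<- <-]] := pullback_exists pullback_qp yx.
    by exists (ofG0 z).
  + by have [z [[<- <-] _]] := h2_lift (esym yx); exists (ofF2e z).
- move=> /and4P[/eqP<- /eqP yx /eqP zy _]; rewrite !colorE.
  case: x y z yx zy => [[x|x]|x] [[y|y]|y] [[z|z]|z] //= yx zy _ _.
  have [t [ty tx]] := pullback_exists pullback_qp yx.
  have [u [[uy uz] _]] := h1_lift (esym zy).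
  (* As in the cube condition, $q_1$ lifts the edge [u] of $F_1$ to an edge of $G$ with source
     [t]. *)
  have [|w [wt wu]] := @q1_lift t u; first by rewrite ty uy.
  by exists w; rewrite /= wt wu ty tx uz.
(* Four strictly increasing colors cannot be found among three. *)
move=> _; rewrite !colorE => /and4P[xy yz zt _]; exfalso.
by case: x y z t xy yz zt => [[x|x]|x] [[y|y]|y] [[z|z]|z] [[t|t]|t].
Qed.

Implicit Types (e x y : edge (GT T)) (s t : seq (edge (GT T))).
Implicit Types (v : vertex (GT T)).

Lemma Lambda_deg_path v s i : is_path v s ->
  Lambda_deg (path_class v s) i = count_mem i (map (@color T) s).
Proof.
move=> p.
by rewrite Lambda_deg_class (@word_degE 3 (GT T) (@color T)) val_mkpath.
Qed.

Lemma sum_count_mem (I : finType) (r : seq I) :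
  (\sum_i count_mem i r = size r)%N.
Proof.
elim: r => [|j r IH] /=; first by rewrite big1.
rewrite big_split /= IH (bigD1 j) //= eqxx big1 // => i ij.
by rewrite eq_sym (negPf ij).
Qed.

Lemma is_cube_path n v s : is_path v s -> uniq (map (@color T) s) ->
  size s = n -> @is_cube 3 L n (path_class v s).
Proof.
move=> p u <-; apply/andP; split.
  apply/forallP => i; rewrite [deg _ _]Lambda_deg_path //.
  by rewrite count_uniq_mem //; case: (_ \in _).
rewrite -(size_map (@color T)) -sum_count_mem; apply/eqP/eq_bigr => i _.
exact: Lambda_deg_path.
Qed.

Lemma map_color_nat s :
  map (fun e => @color T e : nat) s = map (@nat_of_ord 3) (map (@color T) s).
Proof. by rewrite -map_comp. Qed.

Lemma sorted_uniq_color s : sorted ltn (map (fun e => @color T e : nat) s) ->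
  uniq (map (@color T) s).
Proof.
move=> /(sorted_uniq ltn_trans ltnn).
by rewrite map_color_nat map_inj_uniq //; apply: val_inj.
Qed.

Lemma is_cube_cube_path n (x : textile_basis T n) :
  @is_cube 3 L n (path_class (cube_path x).1 (cube_path x).2).
Proof.
have [p st sz] := cube_pathP x.
by apply: is_cube_path => //; apply: sorted_uniq_color.
Qed.

Definition cube_of n (x : textile_basis T n) : cube L n :=
  Sub (path_class (cube_path x).1 (cube_path x).2) (is_cube_cube_path x).

(** Equal classes have equal degrees, so the two strictly increasing color words agree, and a class
    contains only one path with a given color word. *)
Lemma cube_of_inj n : injective (@cube_of n).
Proof.
move=> x y /(congr1 val) /= e.
have [px sx _] := cube_pathP x; have [py sy _] := cube_pathP y.
apply: cube_path_inj;
  rewrite (surjective_pairing (cube_path x)) (surjective_pairing (cube_path y)).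
rewrite -(val_mkpath px) -(val_mkpath py); congr val.
apply: (quot_colors_eq sqP (S := S)) => //;
  first exact: textile_congruence_smallest.
rewrite !val_mkpath //=; apply: (inj_map (@ord_inj 3)); rewrite -!map_color_nat.
apply: (irr_sorted_eq ltn_trans ltnn sx sy); apply: perm_mem.
rewrite !map_color_nat; apply: perm_map; apply/allP => i _ /=.
by rewrite -(Lambda_deg_path i px) -(Lambda_deg_path i py) e.
Qed.

(** The colors of any representative are distinct because the degree of a cube is at most 1 in each
    direction. Rearranging them in increasing order gives a path covered by [cube_path_surj]. *)
Lemma cube_of_surj n (c : cube L n) :
  exists x : textile_basis T n, cube_of x = c.
Proof.
case: c => l lc; have /andP[/forallP l1 /eqP ln] := lc.
pose cs := map (@color T) (val (repr l)).2.
have dE i : deg l i = count_mem i cs by apply: word_degE.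
have csz : size cs = n.
  by rewrite -sum_count_mem -ln; apply: eq_bigr => i _; rewrite dE.
have csu : uniq cs.
  apply: count_mem_uniq => i; move: (l1 i); rewrite dE.
  by rewrite -has_pred1 has_count; case: (count_mem i cs) => [|[|]].
pose w := sort (fun i j : 'I_3 => i <= j)%N cs.
have [||b [bl bw]] := @quot_reorder _ _ _ _ sqP S _ l w.
- exact: textile_sq_congruence.
- by rewrite perm_sort.
have [||x xb] := @cube_path_surj n (val b).1 (val b).2 (valP b).
- rewrite map_color_nat bw ltn_sorted_uniq_leq.
  rewrite map_inj_uniq; last exact: val_inj.
  rewrite sort_uniq csu sorted_map; apply: sort_sorted => i j; exact: leq_total.
- by rewrite -(size_map (@color T)) bw size_sort.
by exists x; apply: val_inj; rewrite /= xb -bl /path_class /= mkpathE.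
Qed.

Lemma cube_of_bij n : bijective (@cube_of n).
Proof. exact: inj_surj_bij (@cube_of_inj n) (@cube_of_surj n). Qed.

(** * Comparison of the boundary maps *)

Lemma path_class_sq v x y y' x' s : is_path v [:: x, y & s] ->
  textile_sq x y y' x' ->
  path_class v [:: x, y & s] = path_class v [:: y', x' & s].
Proof.
move=> p h; apply/quot_classP; apply: S_sq p h; first exact: sqP.
exact: textile_sq_congruence.
Qed.

Lemma path_class_cons v x s t : is_path v (x :: s) -> is_path v (x :: t) ->
  path_class (rng x) s = path_class (rng x) t ->
  path_class v (x :: s) = path_class v (x :: t).
Proof.
move=> ps pt /quot_classP st; apply/quot_classP.
by have [/eqP xv ps'] := andP ps; have [_ pt'] := andP pt; apply: S_cons.
Qed.

(** The path enters through an equation on [l], so each face of one cube can be read from whichever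
    representative starts with the edge to remove; [cgen_face_last] does this at the other end. *)
Lemma cgen_face_first n (l : mor L) v x s i (y : textile_basis T n) :
  l = path_class v (x :: s) -> is_path v (x :: s) -> i = color x ->
  cube_path y = (rng x, s) -> cgen n (face true i l) = << cube_of y >>.
Proof.
move=> -> p -> ys; rewrite (@path_class_cat _ v [:: x] s) //.
have [xv ps] := andP p; have px : is_path v [:: x] by apply/andP.
rewrite face_true.
- by have := valK (cube_of y); rewrite /cgen /= ys => ->.
- by rewrite path_class_dom // path_class_cod.
- by rewrite [LHS]path_class_deg ?big_seq1.
Qed.

Lemma cgen_face_last n (l : mor L) v x s i (y : textile_basis T n) :
  l = path_class v (s ++ [:: x]) -> is_path v (s ++ [:: x]) -> i = color x ->
  cube_path y = (v, s) -> cgen n (face false i l) = << cube_of y >>.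
Proof.
move=> -> p -> ys; rewrite path_class_cat //.
move: p; rewrite is_path_cat => /andP[ps px].
rewrite face_false.
- by have := valK (cube_of y); rewrite /cgen /= ys => ->.
- by rewrite path_class_dom ?path_class_cod.
- by rewrite [LHS]path_class_deg ?big_seq1.
Qed.

(** When no color repeats, the directions of the class are exactly the colors of [s], so the sum
    over directions can be reindexed by edges. *)
Lemma cube_bnd_path n (c : cube L n.+1) v s : val c = path_class v s ->
  is_path v s -> uniq (map (@color T) s) ->
  cube_bnd c = signed_sum (fun x => color x : nat)
    (fun b x => cgen n (face b (color x) (path_class v s : mor L))) s.
Proof.
move=> cE p u; rewrite cube_bndE cE; apply: eq_bigr => b _.
have dirsE i : (i \in dirs (path_class v s : mor L)) = (i \in map (@color T) s).
  rewrite /in_mem /= /dirs [deg _ _]Lambda_deg_path // count_uniq_mem //.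
  by rewrite eqb1.
have rankE i :
    rank (path_class v s : mor L) i = count (fun y => color y < i)%N s.
  rewrite /rank -[RHS](count_map (@color T) (fun j : 'I_3 => j < i)%N).
  rewrite -size_filter -(card_uniqP (filter_uniq _ u)); apply: eq_card => j.
  by rewrite mem_filter inE -dirsE andbC.
under [RHS]eq_bigr do rewrite -rankE.
rewrite -(big_map (@color T) xpredT (fun i =>
  (-1) ^+ ((rank (path_class v s : mor L) i).+1 + b)
   *: cgen n (face b i (path_class v s : mor L)))).
by rewrite [RHS]big_uniq //; apply: eq_bigl => i; rewrite dirsE.
Qed.

(** Both [a b] and [c d] represent the square, and deleting the first or last edge of each gives its
    four faces. *)
Lemma cube_bnd_square (x : textile_basis T 2) v (a b c d : edge (GT T)) :
  cube_path x = (v, [:: a; b]) -> textile_sq a b c d -> (color a < color b)%N ->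
  cube_bnd (cube_of x) =
    << cube_of (a : textile_basis T 1) >>
    + << cube_of (b : textile_basis T 1) >>
    - << cube_of (c : textile_basis T 1) >>
    - << cube_of (d : textile_basis T 1) >>.
Proof.
move=> xE h ab; have [] := cube_pathP x; rewrite xE.
move=> p /sorted_uniq_color u _.
have cE : val (cube_of x) = path_class (cube_path x).1 (cube_path x).2 by [].
have {}cE : val (cube_of x) = path_class v [:: a; b] by rewrite cE xE.
have {}p : is_path v [:: a; b] by exact: p.
have [q1 q2 q3 _] := sq_path sqP h; have [ca cb _] := sq_color sqP h.
have p' := is_path_sq sqP p h; have e := path_class_sq p h.
have av : src a = v by apply/eqP; have [] := andP p.
rewrite (cube_bnd_path cE p u) signed_sum2 //.
rewrite (@cgen_face_first 1 _ v a [:: b] _ b) //; last by rewrite q1.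
rewrite (@cgen_face_first 1 _ v c [:: d] _ d) //; last by rewrite q2.
rewrite (@cgen_face_last 1 _ v b [:: a] _ a) //; last by rewrite -av.
by rewrite (@cgen_face_last 1 _ v d [:: c] _ c) // -av -q3.
Qed.

Lemma free_map_bnd n (x : textile_basis T n.+1) :
  free_map (@cube_of n) (textile_bnd x) = cube_bnd (cube_of x).
Proof.
have [gp gp'] := textile_gp T; have [hq hq'] := textile_hq T.
have [gq gq'] := textile_gq T; have [hp hp'] := textile_hp T.
case: n x => [|[|[|n]]] x; last by case: x.
- have [p /sorted_uniq_color u _] := cube_pathP x.
  rewrite (cube_bnd_path (c := cube_of x) erefl p u) signed_sum1.
  pose y : edge (GT T) := x.
  rewrite (@cgen_face_first 0 _ (src y) y [::] _ (rng y)) //.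
  rewrite (@cgen_face_last 0 _ (src y) y [::] _ (src y)) //.
  rewrite {}/y /textile_bnd /textile_bnd1.
  by case: x p {u} => [[x|x]|x] p; rewrite free_mapB !free_mapU.
- case: x => [[x|x]|x]; rewrite /textile_bnd /textile_bnd2 !free_mapB free_mapD
    !free_mapU.
  + rewrite (cube_bnd_square (x := ofG0 x) erefl
      (c := ofF1 (hom0 (p1 T) x)) (d := ofF2 (hom0 (q2 T) x))) //.
      by exists x.
    by rewrite !colorE.
  + rewrite (cube_bnd_square (x := ofF1e x) erefl
      (c := ofE (hom1 (g1 T) x)) (d := ofF1 (rng x))) //; first by exists x.
    by rewrite !colorE.
  + rewrite (cube_bnd_square (x := ofF2e x) erefl
      (c := ofE (hom1 (g2 T) x)) (d := ofF2 (rng x))) //; first by exists x.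
    by rewrite !colorE.
have [p /sorted_uniq_color u _] := cube_pathP x.
rewrite (cube_bnd_path (c := cube_of x) erefl p u) {u}.
pose v : vertex (GT T) := hom0 (g2 T) (hom0 (p2 T) (src x)).
pose a := ofF2 (hom0 (p2 T) (src x)); pose b := ofF1 (hom0 (q1 T) (src x)).
pose e := ofE (hom1 (h1 T) (hom1 (q1 T) x)).
pose a' := ofF1 (hom0 (p1 T) (src x)); pose b' := ofF2 (hom0 (q2 T) (src x)).
pose e1 := ofE (hom1 (g1 T) (hom1 (q1 T) x)).
pose b1 := ofF1 (hom0 (q1 T) (rng x)); pose a1 := ofF2 (hom0 (p2 T) (rng x)).
pose e2 := ofE (hom1 (g2 T) (hom1 (p2 T) x)).
pose e3 := ofE (hom1 (g2 T) (hom1 (q2 T) x)).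
pose b3 := ofF2 (hom0 (q2 T) (rng x)).
have {}p : @is_path (GT T) v [:: a; b; e] by exact: p.
rewrite -/v -/a -/b -/e signed_sum3 ?colorE //.
have sab : textile_sq a b a' b' by exists (src x).
have sbe : textile_sq b e e1 b1.
  by exists (hom1 (q1 T) x); rewrite hom_src hom_rng.
have sae : textile_sq a e1 e2 a1.
  by exists (hom1 (p2 T) x); rewrite hom_src hom_rng gq'.
have sbe' : textile_sq b' e e3 b3.
  by exists (hom1 (q2 T) x); rewrite hom_src hom_rng hq'.
(* Square moves produce four further representatives of the cube; together the five show each of its
   six faces at an end. *)
have E1 : path_class v [:: a; b; e] = path_class v [:: a'; b'; e].
  exact: path_class_sq sab.
have p' : @is_path (GT T) v [:: a'; b'; e] := is_path_sq sqP p sab.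
have pbe : @is_path (GT T) (rng (a : edge (GT T))) [:: b; e].
  by have [] := andP p.
have pbe' : @is_path (GT T) (rng (a' : edge (GT T))) [:: b'; e].
  by have [] := andP p'.
have pe1 : @is_path (GT T) v [:: a; e1; b1].
  have [av _] := andP p; apply/andP; split=> //.
  exact: (is_path_sq sqP pbe sbe).
have E2 : path_class v [:: a; b; e] = path_class v [:: a; e1; b1].
  by apply: path_class_cons => //; apply: path_class_sq sbe.
have pe2 : @is_path (GT T) v [:: e2; a1; b1] := is_path_sq sqP pe1 sae.
have E3 : path_class v [:: a; b; e] = path_class v [:: e2; a1; b1].
  by rewrite E2; apply: path_class_sq sae.
have pe3 : @is_path (GT T) v [:: a'; e3; b3].
  have [av _] := andP p'; apply/andP; split=> //.
  exact: (is_path_sq sqP pbe' sbe').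
have E4 : path_class v [:: a; b; e] = path_class v [:: a'; e3; b3].
  by rewrite E1; apply: path_class_cons => //; apply: path_class_sq sbe'.
(* The faces are now matched in the order of [signed_sum3]: range, $q_1$, $q_2$, $p_2$, source,
   $p_1$. *)
rewrite /textile_bnd /textile_bnd3 !free_mapB !free_mapD !free_mapU.
rewrite (cgen_face_first (y := ofG0 (rng x)) E3 pe2) //; last first.
  by rewrite /= hom_rng hom_rng.
rewrite (cgen_face_first (y := ofF1e (hom1 (q1 T) x)) erefl p) //; last first.
  by rewrite /= hom_src gq.
rewrite (cgen_face_first (y := ofF2e (hom1 (q2 T) x)) E1 p') //; last first.
  by rewrite /= hom_src hp -hq'.
rewrite (cgen_face_last (s := [:: a; e1])
  (y := ofF2e (hom1 (p2 T) x)) E2 pe1) //; last first.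
  by rewrite /= hom_src -gq'.
rewrite (cgen_face_last (s := [:: a; b]) (y := ofG0 (src x)) erefl p) //.
rewrite (cgen_face_last (s := [:: a'; e3])
  (y := ofF1e (hom1 (p1 T) x)) E4 pe3) //.
by rewrite /= hom_src hp' gp.
Qed.

End TextileKGraph.

Theorem theorem8p8 (T : textile)
    (q1_lift : s_path_lifting (q1 T))
    (g1_lift : unique_r_path_lifting (g1 T))
    (g2_lift : unique_r_path_lifting (g2 T))
    (h1_lift : unique_s_path_lifting (h1 T))
    (h2_lift : unique_s_path_lifting (h2 T))
    (pullback_qp : is_pullback (hom0 (q1 T)) (hom0 (p2 T))
                               (hom0 (g1 T)) (hom0 (h2 T)))
    (pullback_pq : is_pullback (hom0 (p1 T)) (hom0 (q2 T))
                               (hom0 (h1 T)) (hom0 (g2 T))) :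
  exists Lambda_3graph : is_kgraph (@Lambda_deg T),
    let L := KGraph Lambda_3graph in
    complex_iso (textile_complex T) (kgraph_complex L) /\
    forall n : nat,
      zmod_iso (homology (textile_complex T) n) (homology (kgraph_complex L) n).
Proof.
exists (Lambda_kgraph q1_lift g1_lift g2_lift h1_lift h2_lift
  pullback_qp pullback_pq) => L.
have iso : complex_iso (textile_complex T) (kgraph_complex L).
  exact: free_complex_iso (@cube_of_bij _ _ _ _ _ _ _ _)
    (@free_map_bnd _ _ _ _ _ _ _ _).
by split=> //; apply: complex_iso_homology.
Qed.
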